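(* Let $n\ge2$ and let $P^*$ be an extremal polynomial of degree $n$. Then the lemniscate $E_{P^*}(0)$ is singular, i.e. it contains at least one critical point of $P^*$: $$\{z\in\mathbb{C}: (P^* )'(z)=0\}\cap E_{P^*}(0)\neq\varnothing .$$
   Context: For a polynomial $P$, $E_P(0)=\{z\in\mathbb{C}:|P(z)|=1\}$ and $|E_P(0)|$ denotes its length. A monic polynomial $P^*$ of degree $n$ is called extremal if it maximizes the length $|E_P(0)|$ among all monic polynomials $P$ of degree $n$. *)

(* Defs.v *)
From HB Require Import structures.
From mathcomp Require Import all_boot all_order all_algebra.
From mathcomp Require Import all_classical all_reals all_analysis.
From mathcomp Require Import complex.

Set Implicit Arguments.
Unset Strict Implicit.
Unset Printing Implicit Defensive.

Import Order.TTheory GRing.Theory Num.Theory.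
Import ComplexField.Normc.

Local Open Scope classical_set_scope.
Local Open Scope ring_scope.
Local Open Scope complex_scope.

Section HausdorffLength.
Context {R : realType}.
Implicit Types A : set R[i].

(* The maximum with 0 only matters for the empty set, whose supremum in
   \bar R is -oo. The R-valued modulus normc is used since the generic norm of
   R[i] takes its values in R[i]. *)
Definition diameter A : \bar R :=
  maxe 0%E (ereal_sup [set (normc (z.1 - z.2))%:E | z in A `*` A]).

Definition delta_cover (delta : R) A (U : (set R[i])^nat) : Prop :=
  A `<=` \bigcup_k U k /\ forall k, (diameter (U k) <= delta%:E)%E.

Definition hausdorff_content (delta : R) A : \bar R :=
  ereal_inf [set (\sum_(0 <= k <oo) diameter (U k))%E
            | U in [set U | delta_cover delta A U]].

(* Length of a plane set: its one-dimensional Hausdorff measure, normalized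
   so that a segment has its usual length. The limit as delta -> 0+ is a
   supremum because the content is nonincreasing in delta. *)
Definition hausdorff_length A : \bar R :=
  ereal_sup [set hausdorff_content delta A | delta in [set d : R | 0 < d]].

End HausdorffLength.

Definition lemniscate (R : realType) (P : {poly R[i]}) : set R[i] :=
  [set z | `|P.[z]| = 1].

(* Recall that size P is the degree of P plus one. *)
Definition extremal (R : realType) (n : nat) (P : {poly R[i]}) : Prop :=
  [/\ P \is monic, size P = n.+1 &
    forall Q : {poly R[i]}, Q \is monic -> size Q = n.+1 ->
      (hausdorff_length (lemniscate Q) <= hausdorff_length (lemniscate P))%E].

(* Main.v *)
Require Import Defs.
From HB Require Import structures.
From mathcomp Require Import all_boot all_order all_algebra.
From mathcomp Require Import all_classical all_reals all_analysis.
From mathcomp Require Import separable.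
From mathcomp Require Import complex.
From mathcomp Require Import ring lra.

Set Implicit Arguments.
Unset Strict Implicit.
Unset Printing Implicit Defensive.

Import Order.TTheory GRing.Theory Num.Theory.
Import ComplexField.Normc.
Import numFieldNormedType.Exports.

Local Open Scope classical_set_scope.
Local Open Scope ring_scope.
Local Open Scope complex_scope.

(** Suppose that the lemniscate [|P| = 1] of an extremal [P] contains no
    critical point. The idea is that the length of [|P - w| = 1], as a function
    of the complex number [w] near 0, is then strictly subharmonic, so that it
    cannot have a maximum at 0; but each [P - w] is monic of the same degree as
    [P].

    By the change of variables given by the local inverses of [P], the length
    of [|P - w| = 1] is the integral over the unit circle of the sum, over the
    roots [x] of [P = zeta + w], of [1 / |P'(x)|]. Along a branch of the inverse
    of [P], [1 / P'(x)] is a holomorphic function of [w], so its modulus is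
    subharmonic, and strictly so where [P''] does not vanish; this happens
    somewhere on the lemniscate when the degree is at least 2.

    The proof is a discrete version of this argument. The integral is
    replaced by the Riemann sums [riemann_length]. They converge to the Hausdorff
    length of a regular lemniscate: [riemann_upper] covers the lemniscate by
    the preimages of small arcs of the circle, and [riemann_lower] uses slightly
    shorter arcs, whose preimages are at a positive distance from each other,
    and projects each of them on the direction of its chord
    ([hausdorff_length_separated]). The circular mean in [w] is replaced by
    a mean over the four points [r], [ir], [-r], [-ir]. An expansion to order 2
    in [w] gives [pointwise_submean], and [riemann_submean] integrates it: for
    some small [r], the four Riemann sums for [P - w] exceed on average
    the one for [P] by a quantity that does not depend on the mesh. In the limit,
    one of the four lengths exceeds that of [P].

    All constants are uniform along the lemniscate because a polynomial can be
    small only near one of its roots ([root_near], [regular_dataP]). *)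

(** * The real-valued modulus *)

Section ComplexModulus.
Context {R : realType}.
Implicit Types (x y z : R[i]) (p : {poly R[i]}).

Lemma normc_ge0 z : 0 <= normc z.
Proof. by case: z => a b; rewrite /normc sqrtr_ge0. Qed.

Lemma normcD x y : normc (x + y) <= normc x + normc y.
Proof. exact: le_normcD. Qed.

Lemma normc_opp z : normc (- z) = normc z.
Proof. exact: normcN. Qed.

Lemma normcB x y : normc (x - y) = normc (y - x).
Proof. by rewrite -normc_opp opprB. Qed.

Lemma normc_triangle y x z : normc (x - z) <= normc (x - y) + normc (y - z).
Proof. by apply: le_trans (normcD _ _); rewrite addrA subrK. Qed.

Lemma ler_normcB x y : normc x - normc y <= normc (x - y).
Proof. by rewrite lerBlDr -{1}(subrK y x) normcD. Qed.

Lemma ler_dist_normc x y : `|normc x - normc y| <= normc (x - y).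
Proof.
rewrite ler_norml ler_normcB andbT lerNl opprB normcB.
exact: ler_normcB.
Qed.

Lemma normc_eq0 z : (normc z == 0) = (z == 0).
Proof. by apply/eqP/eqP => [/eq0_normc//|->]; rewrite normc0. Qed.

Lemma normc_gt0 z : (0 < normc z) = (z != 0).
Proof. by rewrite lt0r normc_ge0 andbT normc_eq0. Qed.

Lemma normcXn z n : normc (z ^+ n) = normc z ^+ n.
Proof. by elim: n => [|n IH]; rewrite ?expr0 ?normc1// !exprS normcM IH. Qed.

Lemma normc_prod (T : Type) (s : seq T) (F : T -> R[i]) :
  normc (\prod_(t <- s) F t) = \prod_(t <- s) normc (F t).
Proof.
by elim: s => [|t s IH]; rewrite ?big_nil ?normc1// !big_cons normcM IH.
Qed.

Lemma normc_sqr z : normc z ^+ 2 = complex.Re z ^+ 2 + complex.Im z ^+ 2.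
Proof. by case: z => a b; rewrite /normc sqr_sqrtr ?addr_ge0 ?sqr_ge0. Qed.

Lemma ler_Re_normc z : `|complex.Re z| <= normc z.
Proof.
rewrite -ler_sqr ?nnegrE ?normc_ge0// normc_sqr real_normK ?num_real//.
by rewrite lerDl sqr_ge0.
Qed.

Lemma ler_Im_normc z : `|complex.Im z| <= normc z.
Proof.
rewrite -ler_sqr ?nnegrE ?normc_ge0// normc_sqr real_normK ?num_real//.
by rewrite lerDr sqr_ge0.
Qed.

Lemma norm_eq1 z : (`|z| == 1) = (normc z == 1).
Proof.
have -> : `|z| = (normc z)%:C by case: z.
by rewrite (inj_eq (@complexI R) (normc z) 1).
Qed.

End ComplexModulus.

(** * Bounded functions and Taylor remainders *)

Section BoundedFunctions.
Context {R : realType} {T : Type} (D : set T).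
Implicit Types f g : T -> R[i].

(** The constants of all the error terms below come from the stability of this
    predicate under ring operations: none of them is ever computed. *)
Definition bounded_fct f := exists M : R, forall t, D t -> normc (f t) <= M.

Lemma bounded_fct_max f : bounded_fct f ->
  exists2 M : R, 1 <= M & forall t, D t -> normc (f t) <= M.
Proof.
move=> [M hM]; exists (Num.max 1 M) => [|t /hM h]; first by rewrite le_max lexx.
by rewrite le_max h orbT.
Qed.

Lemma bounded_fct_cst c : bounded_fct (fun=> c).
Proof. by exists (normc c). Qed.

Lemma bounded_fctD f g : bounded_fct f -> bounded_fct g ->
  bounded_fct (fun t => f t + g t).
Proof.
move=> [M hM] [N hN]; exists (M + N) => t Dt.
by apply: le_trans (normcD _ _) _; rewrite lerD ?hM ?hN.
Qed.

Lemma bounded_fctM f g : bounded_fct f -> bounded_fct g ->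
  bounded_fct (fun t => f t * g t).
Proof.
move=> [M hM] [N hN]; exists (M * N) => t Dt.
by rewrite normcM ler_pM ?normc_ge0 ?hM ?hN.
Qed.

Lemma bounded_fctN f : bounded_fct f -> bounded_fct (fun t => - f t).
Proof. by move=> [M hM]; exists M => t Dt; rewrite normc_opp hM. Qed.

Lemma bounded_fctX f n : bounded_fct f -> bounded_fct (fun t => f t ^+ n).
Proof.
move=> [M hM]; exists (M ^+ n) => t Dt; rewrite normcXn.
by rewrite lerXn2r ?nnegrE ?normc_ge0 ?hM// (le_trans (normc_ge0 _) (hM _ Dt)).
Qed.

Lemma bounded_fctV f (c : R) : 0 < c -> (forall t, D t -> c <= normc (f t)) ->
  bounded_fct (fun t => (f t)^-1).
Proof.
move=> c0 hc; exists c^-1 => t /hc h; rewrite normcV lef_pV2 ?posrE//.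
exact: lt_le_trans h.
Qed.

Lemma bounded_fct_sum (I : Type) (s : seq I) (F : I -> T -> R[i]) :
  (forall i, bounded_fct (F i)) -> bounded_fct (fun t => \sum_(i <- s) F i t).
Proof.
move=> hF; elim: s => [|i s IH].
  by exists 0 => t _; rewrite big_nil normc0.
have [M hM] := bounded_fctD (hF i) IH.
by exists M => t Dt; rewrite big_cons hM.
Qed.

Lemma bounded_fct_horner f (p : {poly R[i]}) : bounded_fct f ->
  bounded_fct (fun t => p.[f t]).
Proof.
move=> hf.
have [M hM] : bounded_fct (fun t => \sum_(i < size p) p`_i * f t ^+ i).
  apply: bounded_fct_sum => i; apply: bounded_fctM; first exact: bounded_fct_cst.
  exact: bounded_fctX.
by exists M => t /hM; rewrite horner_coef.
Qed.

End BoundedFunctions.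

Section Taylor.
Context {R : realType}.
Implicit Types (p q : {poly R[i]}) (x y z h : R[i]).

Definition taylor_rem k p x h : R[i] := \sum_(i < size p) p^`N(k + i).[x] * h ^+ i.

Lemma taylor_expansion k p x h :
  p.[x + h] = \sum_(i < k) p^`N(i).[x] * h ^+ i + h ^+ k * taylor_rem k p x h.
Proof.
rewrite (@nderiv_taylor_wide _ (k + size p)) ?leq_addl//; last exact: mulrC.
rewrite big_split_ord/=; congr (_ + _).
rewrite mulr_sumr; apply: eq_bigr => i _.
by rewrite exprD mulrCA.
Qed.

Definition ball_pairs (B : R) : set (R[i] * R[i]) :=
  [set t | normc t.1 <= B /\ normc t.2 <= B].

Lemma bounded_taylor_rem k p (B : R) :
  bounded_fct (ball_pairs B) (fun t => taylor_rem k p t.1 t.2).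
Proof.
apply: bounded_fct_sum => i; apply: bounded_fctM.
  by apply: bounded_fct_horner; exists B => t [].
by apply: bounded_fctX; exists B => t [].
Qed.

Lemma poly_lipschitz p (B : R) : exists2 M : R, 1 <= M &
  forall x y, normc x <= B -> normc y <= B ->
    normc (p.[x] - p.[y]) <= M * normc (x - y).
Proof.
have [M M1 hM] := bounded_fct_max (bounded_taylor_rem 1 p (B + B)).
exists M => // x y xB yB; rewrite -{1}(subrK y x) [X in p.[X]]addrC (taylor_expansion 1).
rewrite big_ord1 expr1 expr0 mulr1 nderivn0 addrAC subrr add0r normcM mulrC.
have B0 := normc_ge0 x.
rewrite ler_wpM2r ?normc_ge0//.
apply: (hM (y, x - y)); split => /=; first by lra.
by apply: le_trans (normcD _ _) _; rewrite normc_opp lerD.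
Qed.

(** The slope is taken at a third point [z], because [x] and [y] will run over
    a whole piece of a level curve while [z] stays at its root of reference.
    The error is the Taylor remainder at [y], plus the variation of the
    derivative between [y] and [z]. *)
Lemma poly_almost_linear p (B : R) : exists2 L : R, 1 <= L &
  forall z x y (s : R), normc x <= B -> normc y <= B -> normc z <= B ->
    normc (x - z) <= s -> normc (y - z) <= s ->
    normc (p.[x] - p.[y] - p^`().[z] * (x - y)) <= L * s * normc (x - y).
Proof.
have [M M1 hM] := bounded_fct_max (bounded_taylor_rem 2 p (B + B)).
have [N N1 hN] := poly_lipschitz p^`() B.
exists (M + M + N) => [|z x y s xB yB zB xs ys]; first by lra.
have s0 : 0 <= s := le_trans (normc_ge0 _) xs.
have -> : p.[x] - p.[y] - p^`().[z] * (x - y) =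
    (x - y) * taylor_rem 2 p y (x - y) * (x - y) + (p^`().[y] - p^`().[z]) * (x - y).
  rewrite -{1}(subrK y x) [X in p.[X]]addrC (taylor_expansion 2).
  rewrite !big_ord_recr big_ord0/= nderivn0 nderivn1.
  ring.
apply: le_trans (normcD _ _) _; rewrite !normcM -mulrDl ler_wpM2r ?normc_ge0//.
have h1 : normc (x - y) <= s + s.
  by apply: le_trans (normc_triangle z _ _) _; rewrite lerD// normcB.
have h2 : normc (taylor_rem 2 p y (x - y)) <= M.
  apply: (hM (y, x - y)); split => /=; first by have := normc_ge0 x; lra.
  by apply: le_trans (normcD _ _) _; rewrite normc_opp lerD.
have h3 := hN _ _ yB zB.
have h4 : normc (x - y) * normc (taylor_rem 2 p y (x - y)) <= (s + s) * M.
  by rewrite ler_pM ?normc_ge0.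
have h5 : N * normc (y - z) <= N * s by rewrite ler_wpM2l//; lra.
lra.
Qed.

End Taylor.

(** * Regular polynomials and their local inverses *)

Section RootsNearby.
Context {R : realType}.
Implicit Types (p Q : {poly R[i]}) (z : R[i]).

Definition roots_of p : seq R[i] := sval (closed_field_poly_normal p).

Lemma roots_ofE p : p = lead_coef p *: \prod_(x <- roots_of p) ('X - x%:P).
Proof. exact: svalP (closed_field_poly_normal p). Qed.

Lemma size_roots_of p : p != 0 -> size p = (size (roots_of p)).+1.
Proof.
by move=> p0; rewrite {1}(roots_ofE p) size_scale ?lead_coef_eq0// size_prod_XsubC.
Qed.

Lemma mem_roots_of p z : p != 0 -> (z \in roots_of p) = (p.[z] == 0).
Proof.
move=> p0; rewrite -[RHS]/(root p z) {2}(roots_ofE p).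
by rewrite rootZ ?lead_coef_eq0// root_prod_XsubC.
Qed.

Lemma normc_horner_roots p z :
  normc p.[z] = normc (lead_coef p) * \prod_(x <- roots_of p) normc (z - x).
Proof.
rewrite {1}(roots_ofE p) hornerZ normcM horner_prod normc_prod.
by congr (_ * _); apply: eq_bigr => x _; rewrite hornerXsubC.
Qed.

Lemma size_derivC p : size p^`() = (size p).-1.
Proof.
case sp: (size p) => [|[|m]].
- by move/eqP: sp; rewrite size_poly_eq0 => /eqP->; rewrite deriv0 size_poly0.
- by have /eq_leq/size1_polyC-> := sp; rewrite derivC size_poly0.
apply/eqP; rewrite eqn_leq -ltnS -{1}sp lt_size_deriv -?size_poly_eq0 ?sp//=.
rewrite ltnNge; apply/negP => /leq_sizeP/(_ _ (leqnn _))/eqP.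
rewrite coef_deriv mulrn_eq0/= -[m.+1]/m.+2.-1 -sp -/(lead_coef p).
by rewrite lead_coef_eq0 -size_poly_eq0 sp.
Qed.

(** A polynomial can only be small near one of its roots, as its modulus is the
    product of the distances to the roots. This replaces both compactness and
    the inverse function theorem: applied to [p], to its derivative and to
    [p - zeta] it bounds level sets, bounds the derivative from below near the
    lemniscate, and solves equations locally. *)
Lemma root_near p z (s : R) : 0 <= s -> p != 0 ->
  normc p.[z] < normc (lead_coef p) * s ^+ (size p).-1 ->
  exists2 x, x \in roots_of p & normc (z - x) < s.
Proof.
move=> s0 p0; apply: contraPP => noroot.
have far x : x \in roots_of p -> s <= normc (z - x).
  move=> xp; rewrite leNgt; apply/negP => xz; apply: noroot.
  by exists x.
apply/negP; rewrite -leNgt normc_horner_roots size_roots_of//=.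
rewrite ler_wpM2l ?normc_ge0//.
elim: (roots_of p) far => [|x r IH] far; first by rewrite big_nil expr0.
rewrite big_cons/= exprS ler_pM ?exprn_ge0 ?far ?mem_head//.
by apply: IH => y yr; apply: far; rewrite inE yr orbT.
Qed.

Lemma seq_bounded_below (T : eqType) (r : seq T) (f : T -> R) :
  (forall x, x \in r -> 0 < f x) ->
  exists2 m : R, 0 < m & forall x, x \in r -> m <= f x.
Proof.
elim: r => [|x r IH] hf; first by exists 1.
have [m m0 hm] : exists2 m : R, 0 < m & forall x, x \in r -> m <= f x.
  by apply: IH => y yr; apply: hf; rewrite inE yr orbT.
exists (Num.min m (f x)) => [|y].
  by rewrite lt_min m0 hf// mem_head.
rewrite inE => /predU1P[->|/hm my]; rewrite ge_min ?lexx ?orbT//.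
by rewrite my.
Qed.

Lemma seq_bounded_above (T : eqType) (r : seq T) (f : T -> R) :
  exists2 m : R, 1 <= m & forall x, x \in r -> f x <= m.
Proof.
elim: r => [|x r [m m0 hm]]; first by exists 1.
exists (Num.max m (f x)) => [|y]; first by rewrite le_max m0.
rewrite inE => /predU1P[->|/hm my]; rewrite le_max ?lexx ?orbT//.
by rewrite my.
Qed.

End RootsNearby.

Section RegularPolynomial.
Context {R : realType}.
Implicit Types (Q : {poly R[i]}) (x y z : R[i]).

(** The negation of the conclusion of the main theorem. *)
Definition regular Q := forall z, normc Q.[z] = 1 -> Q^`().[z] != 0.

(** The uniform constants attached to a regular polynomial: [c] bounds the
    derivative from below on the [eta]-neighbourhood of the level 1, and on
    discs of radius [rho] centred there the polynomial is so close to linear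
    (by the choice of [L * rho]) that it is injective. *)
Record regular_data n Q (B c eta rho L : R) : Prop := RegularData {
  rd_monic : Q \is monic;
  rd_size : size Q = n.+1;
  rd_c : 0 < c;
  rd_eta : 0 < eta <= 1;
  rd_rho : 0 < rho <= 1;
  rd_B : 0 <= B;
  rd_L : 0 <= L;
  rd_Lrho : L * rho <= c / 2;
  rd_bounded : forall z, normc Q.[z] <= 2 -> normc z <= B;
  rd_deriv : forall z, `|normc Q.[z] - 1| <= eta -> c <= normc Q^`().[z];
  rd_linear : forall z x y (s : R), normc z <= B ->
    normc (x - z) <= s -> normc (y - z) <= s -> s <= rho ->
    normc (Q.[x] - Q.[y] - Q^`().[z] * (x - y)) <= L * s * normc (x - y);
  rd_lipschitz : forall x y, normc x <= B + 1 -> normc y <= B + 1 ->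
    normc (Q.[x] - Q.[y]) <= L * normc (x - y) }.

(** The bound [c] exists because, where the derivative is small, a critical
    point is close; the modulus of [Q] is then close to a critical value, and
    the finitely many moduli of critical values avoid 1. *)
Lemma regular_dataP n Q : (0 < n)%N -> Q \is monic -> size Q = n.+1 ->
  regular Q -> exists B c eta rho L, regular_data n Q B c eta rho L.
Proof.
move=> n0 Qm Qs Qreg.
have Q0 : Q != 0 by rewrite -size_poly_eq0 Qs.
have dQ0 : Q^`() != 0.
  by rewrite -size_poly_eq0 size_derivC Qs/= -lt0n.
have [B0 B01 hB0] := seq_bounded_above (roots_of Q) (fun x => normc x).
pose B := B0 + 3.
have hB z : normc Q.[z] <= 2 -> normc z <= B.
  move=> Qz; have [||x xQ zx] := @root_near R Q z 3 _ Q0.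
  - lra.
  - rewrite (monicP Qm) normc1 mul1r Qs/=.
    apply: le_lt_trans Qz _; apply: (@lt_le_trans _ _ 3); first by lra.
    by apply: ler_eXnr => //; lra.
  - have := ler_normcB z x; have := hB0 _ xQ; rewrite /B; lra.
have [L1 L11 hL1] := poly_lipschitz Q (B + 1).
have [L2 L21 hL2] := poly_almost_linear Q (B + 1).
pose f x := `|normc Q.[x] - 1|.
have [m m0 hm] : exists2 m : R, 0 < m & forall x, x \in roots_of Q^`() -> m <= f x.
  apply: seq_bounded_below => x; rewrite mem_roots_of// => dx.
  rewrite normr_gt0 subr_eq0; apply: contraL dx => /eqP; exact: Qreg.
pose eta := Num.min (m / 2) 1.
have eta0 : 0 < eta <= 1 by rewrite lt_min ltr01 ge_min lexx orbT divr_gt0.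
have etam : eta <= m / 2 by rewrite ge_min lexx.
pose s := Num.min (m / (4 * L1)) 1.
have s0 : 0 < s by rewrite lt_min ltr01 divr_gt0//; lra.
have s1 : s <= 1 by rewrite ge_min lexx orbT.
have sm : L1 * s < m / 2.
  have : L1 * s <= L1 * (m / (4 * L1)).
    by rewrite ler_pM2l ?ge_min ?lexx//; lra.
  have -> : L1 * (m / (4 * L1)) = m / 4 by field; rewrite lt0r_neq0//; lra.
  lra.
pose c := normc (lead_coef Q^`()) * s ^+ (size Q^`()).-1.
have c0 : 0 < c by rewrite mulr_gt0 ?exprn_gt0// normc_gt0 lead_coef_eq0.
pose L := L1 + L2.
pose rho := Num.min (c / (2 * L)) 1.
exists B, c, eta, rho, L; split => //.
- by rewrite lt_min ltr01 ge_min lexx orbT divr_gt0// /L; lra.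
- by rewrite /B; lra.
- by rewrite /L; lra.
- have : L * rho <= L * (c / (2 * L)).
    by rewrite ler_pM2l ?ge_min ?lexx// /L; lra.
  by have -> : L * (c / (2 * L)) = c / 2 by field; rewrite lt0r_neq0// /L; lra.
- move=> z Qz; rewrite leNgt; apply/negP => dz.
  have [x xQ zx] := root_near (ltW s0) dQ0 dz.
  have zB : normc z <= B.
    by apply: hB; move: Qz; rewrite ler_norml => /andP[_]; lra.
  have xB : normc x <= B + 1.
    by have := ler_normcB x z; rewrite normcB; lra.
  have zB' : normc z <= B + 1 by lra.
  have h1 := hL1 _ _ zB' xB.
  have h2 : L1 * normc (z - x) <= L1 * s by rewrite ler_wpM2l//; lra.
  (* otherwise [z], which is close to the critical point [x], would be too far
     from the level 1 *)
  have h3 : f x <= f z + normc (Q.[z] - Q.[x]).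
    rewrite /f -lerBlDl; apply: le_trans (lerB_dist _ _) _.
    by rewrite opprB addrA subrK distrC ler_dist_normc.
  have := hm _ xQ; rewrite -/(f z) in Qz; clear - h1 h2 h3 Qz etam sm; lra.
- move=> z x y t zB xs ys ts.
  have trho : t <= 1 by apply: le_trans ts _; rewrite ge_min lexx orbT.
  have Bx u : normc (u - z) <= t -> normc u <= B + 1.
    by move=> ?; have := ler_normcB u z; lra.
  apply: le_trans (hL2 z x y t (Bx _ xs) (Bx _ ys) _ xs ys) _; first by lra.
  rewrite ler_wpM2r ?normc_ge0// ler_wpM2r//; last by rewrite /L; lra.
  exact: le_trans (normc_ge0 _) xs.
- move=> x y xB yB; apply: le_trans (hL1 _ _ xB yB) _.
  by rewrite ler_wpM2r ?normc_ge0// /L; lra.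
Qed.

Definition fiber Q zeta := roots_of (Q - zeta%:P).

Section WithData.
Variables (n : nat) (Q : {poly R[i]}) (B c eta rho L : R).
Hypothesis dQ : regular_data n Q B c eta rho L.

Let lead1 zeta : (0 < n)%N -> lead_coef (Q - zeta%:P) = 1.
Proof.
move=> n0; rewrite lead_coefDl ?(monicP (rd_monic dQ))//.
by rewrite size_polyN (rd_size dQ) (leq_ltn_trans (size_polyC_leq1 _)).
Qed.

Lemma size_fiber_poly zeta : (0 < n)%N -> size (Q - zeta%:P) = n.+1.
Proof.
move=> n0; rewrite size_polyDl (rd_size dQ)//.
by rewrite size_polyN (leq_ltn_trans (size_polyC_leq1 _)).
Qed.

Hypothesis n_gt0 : (0 < n)%N.

Let fiber_neq0 zeta : Q - zeta%:P != 0.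
Proof. by rewrite -size_poly_eq0 size_fiber_poly. Qed.

Lemma mem_fiber zeta x : (x \in fiber Q zeta) = (Q.[x] == zeta).
Proof. by rewrite mem_roots_of ?fiber_neq0// hornerD hornerN hornerC subr_eq0. Qed.

Lemma size_fiber zeta : size (fiber Q zeta) = n.
Proof.
by apply: succn_inj; rewrite -size_roots_of ?fiber_neq0// size_fiber_poly.
Qed.

(** A multiple root would be a critical point near the lemniscate. *)
Lemma uniq_fiber zeta : `|normc zeta - 1| <= eta -> uniq (fiber Q zeta).
Proof.
move=> hz; rewrite -separable_prod_XsubC.
have -> : \prod_(x <- fiber Q zeta) ('X - x%:P) = Q - zeta%:P.
  by rewrite [RHS]roots_ofE lead1// scale1r.
rewrite unlock; apply/Pdiv.ClosedField.root_coprimep => x.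
rewrite rootE -mem_roots_of ?fiber_neq0// mem_fiber => /eqP Qx.
rewrite derivB derivC subr0 -normc_gt0; apply: lt_le_trans (rd_c dQ) _.
by apply: (rd_deriv dQ); rewrite Qx.
Qed.

Lemma root_close (z zeta : R[i]) : normc (Q.[z] - zeta) < rho ^+ n ->
  exists2 x, x \in fiber Q zeta & normc (x - z) <= rho.
Proof.
move=> Qz; have [/andP[rho0 _]] := rd_rho dQ.
have [|x xf zx] := root_near (z := z) (ltW rho0) (fiber_neq0 zeta).
  by rewrite lead1// normc1 mul1r size_fiber_poly// hornerD hornerN hornerC.
by exists x => //; rewrite normcB ltW.
Qed.

Lemma linear_upper z x y (s : R) : normc z <= B ->
  normc (x - z) <= s -> normc (y - z) <= s -> s <= rho ->
  normc (Q.[x] - Q.[y]) <= (normc Q^`().[z] + L * s) * normc (x - y).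
Proof.
move=> zB xs ys sr; have := rd_linear dQ zB xs ys sr.
have := ler_normcB (Q.[x] - Q.[y]) (Q^`().[z] * (x - y)).
rewrite normcM; lra.
Qed.

Lemma linear_lower z x y (s : R) : normc z <= B ->
  normc (x - z) <= s -> normc (y - z) <= s -> s <= rho ->
  (normc Q^`().[z] - L * s) * normc (x - y) <= normc (Q.[x] - Q.[y]).
Proof.
move=> zB xs ys sr; have := rd_linear dQ zB xs ys sr.
have := ler_normcB (Q^`().[z] * (x - y)) (Q.[x] - Q.[y]).
rewrite [X in _ <= X -> _]normcB normcM; lra.
Qed.

Lemma near_level_bounded z : `|normc Q.[z] - 1| <= eta -> normc z <= B.
Proof.
move=> Qz; apply: (rd_bounded dQ); have /andP[_ e1] := rd_eta dQ.
by move: Qz; rewrite ler_norml => /andP[_]; lra.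
Qed.

Lemma local_expansion z x y : `|normc Q.[z] - 1| <= eta ->
  normc (x - z) <= rho -> normc (y - z) <= rho ->
  c / 2 * normc (x - y) <= normc (Q.[x] - Q.[y]).
Proof.
move=> Qz xs ys.
have := linear_lower (near_level_bounded Qz) xs ys (lexx _); apply: le_trans.
rewrite ler_wpM2r ?normc_ge0//.
have := rd_deriv dQ Qz; have := rd_Lrho dQ; lra.
Qed.

Lemma local_injective z x y : `|normc Q.[z] - 1| <= eta ->
  normc (x - z) <= rho -> normc (y - z) <= rho -> Q.[x] = Q.[y] -> x = y.
Proof.
move=> Qz xs ys Qxy; have := local_expansion Qz xs ys.
rewrite Qxy subrr normc0 pmulr_rle0 ?divr_gt0 ?(rd_c dQ)// => h.
by apply/eqP; rewrite -subr_eq0 -normc_eq0 eq_le h normc_ge0.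
Qed.

(** Existence comes from [root_close], which only locates the root within
    [rho]; the estimate [local_expansion] then improves the distance to a
    Lipschitz bound. *)
Lemma local_inverse z zeta : `|normc Q.[z] - 1| <= eta ->
  normc (Q.[z] - zeta) < rho ^+ n ->
  exists x, [/\ x \in fiber Q zeta, Q.[x] = zeta, normc (x - z) <= rho &
    normc (x - z) <= 2 / c * normc (zeta - Q.[z])].
Proof.
move=> Qz /root_close[x xf xz]; have c0 := rd_c dQ.
have /andP[r0 _] := rd_rho dQ.
have Qx : Q.[x] = zeta by apply/eqP; rewrite -mem_fiber.
exists x; split=> //; have := @local_expansion z x z Qz xz.
rewrite subrr normc0 (ltW r0) Qx => /(_ isT) h.
have -> : normc (x - z) = 2 / c * (c / 2 * normc (x - z)) by field; rewrite lt0r_neq0//; lra.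
by rewrite ler_wpM2l// divr_ge0//; lra.
Qed.

End WithData.
End RegularPolynomial.

(** * The unit circle *)

Section UnitCircle.
Context {R : realType}.
Implicit Types (s t x : R) (z : R[i]).

Definition expi t : R[i] := cos t +i* sin t.

Lemma expiD s t : expi (s + t) = expi s * expi t.
Proof. by rewrite /expi sinD cosD; simpc; rewrite [sin s * _ + _]addrC. Qed.

Lemma expi0 : expi 0 = 1.
Proof. by rewrite /expi cos0 sin0. Qed.

Lemma normc_expi t : normc (expi t) = 1.
Proof. by rewrite /normc/= cos2Dsin2 sqrtr1. Qed.

Lemma normc_expiB_sqr s t : normc (expi s - expi t) ^+ 2 = 2 - 2 * cos (s - t).
Proof.
rewrite normc_sqr /expi; simpc => /=; rewrite cosB.
have := cos2Dsin2 s; have := cos2Dsin2 t.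
move: (cos s) (cos t) (sin s) (sin t) => a b c d h1 h2.
have -> : 2 - 2 * (a * b + c * d) = (a ^+ 2 + c ^+ 2) + (b ^+ 2 + d ^+ 2) - 2 * (a * b + c * d).
  by rewrite h1 h2.
by ring.
Qed.

Lemma normc_expiB s t : normc (expi s - expi t) = 2 * `|sin ((s - t) / 2)|.
Proof.
have h : normc (expi s - expi t) ^+ 2 = (2 * `|sin ((s - t) / 2)|) ^+ 2.
  rewrite normc_expiB_sqr exprMn real_normK ?num_real// sin2cos2.
  have -> : cos (s - t) = cos ((s - t) / 2 *+ 2) by congr cos; field.
  by rewrite cos_mulr2n; ring.
by apply: (pexpIrn _ _ _ h) => //; rewrite nnegrE ?mulr_ge0 ?normc_ge0.
Qed.

Lemma sin_mvt x : 0 < x -> exists2 c : R, 0 < c < x & sin x = x * cos c.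
Proof.
move=> x0; have [|c] := @MVT R sin cos 0 x x0.
  by apply: continuous_subspaceT => y; exact: continuous_sin.
by rewrite in_itv/= sin0 !subr0 mulrC => cx ->; exists c.
Qed.

Lemma ler_norm_sin x : `|sin x| <= `|x|.
Proof.
wlog x0 : x / 0 < x => [h|].
  have [/h//|x0|<-] := ltrgtP 0 x; last by rewrite sin0 normr0.
  by rewrite -normrN -sinN -[X in _ <= X]normrN h// oppr_gt0.
have [c _ ->] := sin_mvt x0; rewrite normrM ler_piMr//; exact: cos_max.
Qed.

Lemma cos_ge x : 1 - x ^+ 2 / 2 <= cos x.
Proof.
have -> : cos x = 1 - 2 * sin (x / 2) ^+ 2.
  have -> : cos x = cos (x / 2 *+ 2) by congr cos; field.
  by rewrite cos_mulr2n cos2sin2; ring.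
have := ler_norm_sin (x / 2); rewrite -ler_sqr ?nnegrE//.
rewrite !real_normK ?num_real// expr_div_n; lra.
Qed.

Lemma sin_ge x : 0 <= x -> x * (1 - x ^+ 2 / 2) <= sin x.
Proof.
rewrite le_eqVlt => /predU1P[<-|x0]; first by rewrite mul0r sin0.
have [c /andP[c0 cx] ->] := sin_mvt x0; rewrite ler_pM2l//.
apply: le_trans (cos_ge c); rewrite lerD2l lerN2 ler_pM2r//.
by rewrite ler_sqr ?nnegrE ltW.
Qed.

Lemma normc_expiB_le s t : normc (expi s - expi t) <= `|s - t|.
Proof.
rewrite normc_expiB; have := ler_norm_sin ((s - t) / 2).
by rewrite normrM (@ger0_norm _ 2^-1)//; lra.
Qed.

(** The cubic correction makes a chord asymptotic to its arc as [x] tends to 0. *)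
Lemma normc_expiB_ge s x : 0 <= x -> x * (1 - x ^+ 2) <= normc (expi (s + x) - expi s).
Proof.
move=> x0; rewrite normc_expiB addrAC subrr add0r.
have := @sin_ge (x / 2); rewrite divr_ge0// => /(_ isT).
have := ler_norm (sin (x / 2)).
have : 0 <= x * x ^+ 2 by rewrite mulr_ge0// sqr_ge0.
rewrite expr_div_n; lra.
Qed.

Lemma normc_expiB_sep s t (d : R) : 0 < d -> d <= `|s - t| <= pi *+ 2 - d ->
  2 - 2 * cos d <= normc (expi s - expi t) ^+ 2 /\ 0 < 2 - 2 * cos d.
Proof.
move=> d0; rewrite normc_expiB_sqr -[cos (s - t)]cos_norm.
move: `|s - t| => x /andP[dx xd]; have pi0 := pi_gt0 R.
have dpi : d <= pi by rewrite mulr2n in xd; lra.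
have : cos x <= cos d.
  have [xpi|xpi] := leP x pi; first by rewrite leNgt ltr_cos ?in_itv/= -?leNgt//; lra.
  rewrite -(cosN x) -(cosD2pi (- x)) leNgt ltr_cos ?in_itv/= -?leNgt//; rewrite ?mulr2n in xd *; lra.
have : cos d < 1 by rewrite -[X in _ < X]cos0 ltr_cos ?in_itv/=; lra.
by move=> *; split; lra.
Qed.

Lemma expi_surj z t0 : normc z = 1 -> exists2 t, 0 <= t < pi *+ 2 & z = expi (t0 + t).
Proof.
wlog -> : z t0 / t0 = 0 => [h|].
  move=> z1; have [|t t2 ht] := h (z * expi (- t0)) 0 erefl.
    by rewrite normcM z1 normc_expi mulr1.
  exists t => //; rewrite add0r in ht.
  by rewrite expiD -ht mulrCA -expiD subrr expi0 mulr1.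
case: z => a b z1; have pi0 := pi_gt0 R.
have ab : a ^+ 2 + b ^+ 2 = 1 by have := normc_sqr (a +i* b); rewrite z1 expr1n.
have a1 : -1 <= a <= 1.
  by rewrite -ler_norml -(@expr_le1 _ 2)// real_normK ?num_real// -ab lerDl sqr_ge0.
have sa : sin (acos a) = `|b|.
  by rewrite sin_acos// -ab addrAC subrr add0r sqrtr_sqr.
have ca : cos (acos a) = a by apply: acosK; rewrite in_itv.
have a0 := acos_ge0 a1; have api := acos_lepi a1.
have [b0|b0] := leP 0 b.
  exists (acos a); first by rewrite mulr2n; lra.
  by rewrite add0r /expi ca sa ger0_norm.
exists (pi *+ 2 - acos a).
  suff : 0 < acos a by rewrite mulr2n; lra.
  rewrite lt0r a0 andbT; apply/eqP => h; move: sa; rewrite h sin0 => /esym/eqP.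
  by rewrite normr_eq0 => /eqP b00; rewrite b00 ltxx in b0.
rewrite add0r addrC /expi cosD2pi sinD2pi cosN sinN ca sa ltr0_norm ?opprK//.
Qed.

End UnitCircle.

(** * Bounding the Hausdorff length by finite covers and by projections *)

Section HausdorffBounds.
Context {R : realType}.
Implicit Types (A U K : set R[i]).

Lemma diameter_ge0 U : (0 <= diameter U)%E.
Proof. by rewrite /diameter le_max lexx. Qed.

Lemma diameter_ub U x y : U x -> U y -> ((normc (x - y))%:E <= diameter U)%E.
Proof.
move=> Ux Uy; rewrite /diameter le_max; apply/orP; right.
by apply: ereal_sup_ubound; exists (x, y).
Qed.

Lemma diameter_le U (d : R) : 0 <= d ->
  (forall x y, U x -> U y -> normc (x - y) <= d) -> (diameter U <= d%:E)%E.
Proof.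
move=> d0 hd; rewrite /diameter ge_max lee_fin d0/=.
by apply: ge_ereal_sup => _ [[x y] [/= Ux Uy] <-]; rewrite lee_fin hd.
Qed.

Lemma hausdorff_content_finite_cover (I : finType) A (V : I -> set R[i])
    (d : I -> R) (delta : R) :
  0 <= delta -> (forall z, A z -> exists i, V i z) ->
  (forall i, 0 <= d i <= delta) ->
  (forall i x y, V i x -> V i y -> normc (x - y) <= d i) ->
  (hausdorff_content delta A <= (\sum_i d i)%:E)%E.
Proof.
move=> delta0 AV dd hV.
pose U k : set R[i] := if insub k is Some j then V (@enum_val I predT j) else set0.
have UE (j : 'I_#|I|) : U j = V (enum_val j) by rewrite /U valK.
have U0 k : (#|I| <= k)%N -> U k = set0 by move=> h; rewrite /U insubF// ltnNge h.
have diamV i : (diameter (V i) <= (d i)%:E)%E.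
  by apply: diameter_le => [|x y]; [have /andP[] := dd i|exact: hV].
have diam0 : diameter (set0 : set R[i]) = 0%E.
  by apply/eqP; rewrite eq_le diameter_ge0 andbT; exact: diameter_le.
have Udelta k : (diameter (U k) <= delta%:E)%E.
  have [kI|kI] := ltnP k #|I|; last by rewrite U0// diam0 lee_fin.
  have := UE (Ordinal kI) => /= ->; apply: le_trans (diamV _) _.
  by rewrite lee_fin; have /andP[] := dd (enum_val (Ordinal kI)).
apply: (@le_trans _ _ (\sum_(0 <= k <oo) diameter (U k))%E).
  apply: ereal_inf_lbound; exists U => //; split => //.
    move=> z /AV[i Vi]; exists (enum_rank i) => //.
    by rewrite UE enum_rankK.
rewrite (@nneseries_split _ _ 0%N #|I|); last by move=> *; exact: diameter_ge0.
rewrite [X in (_ + X)%E]eseries0 ?adde0; last by move=> k hk _; rewrite U0.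
rewrite add0n big_mkord -sumEFin [X in (_ <= X)%E](big_enum_val (A := predT)) /=.
by apply: lee_sum => j _; rewrite UE diamV.
Qed.

Definition nonexpansive (f : R[i] -> R) :=
  forall x y, `|f x - f y| <= normc (x - y).

(** For a curve, [f] will be the projection on the direction of its chord, and
    [l] a lower bound for the length of the chord. *)
Definition wide K (l : R) := exists f a, nonexpansive f /\
  forall t, a <= t <= a + l -> exists2 z, K z & f z = t.

(** The images of the sets of a cover are contained in intervals no longer than
    the diameters, so that the countable subadditivity of Lebesgue measure
    applies. Only the sets that meet [K] are charged. *)
Lemma shadow_cover K (l delta : R) (U : (set R[i])^nat) : 0 <= l -> wide K l ->
  delta_cover delta K U ->
  (l%:E <= \sum_(0 <= k <oo) if `[< U k `&` K !=set0 >] then diameter (U k) else 0)%E.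
Proof.
move=> l0 [f [a [fne fK]]] [KU Udelta].
pose S k := f @` U k.
pose meets k := `[< U k `&` K !=set0 >].
pose J k := if meets k then `[inf (S k), sup (S k)]%classic else set0.
pose D k := fine (diameter (U k)).
have DE k : diameter (U k) = (D k)%:E.
  rewrite fineK// fin_numE; have h := Udelta k; have h0 := diameter_ge0 (U k).
  by apply/andP; split; apply/eqP => e; move: h h0; rewrite e.
have SD k x y : U k x -> U k y -> f x <= f y + D k.
  move=> Ux Uy; have := diameter_ub Ux Uy; rewrite DE lee_fin.
  have := fne x y; have := ler_norm (f x - f y); lra.
have S_ub k x : U k x -> has_ubound (S k).
  by move=> Ux; exists (f x + D k) => _ [y Uy <-]; exact: SD.
have S_lb k x : U k x -> has_lbound (S k).
  by move=> Ux; exists (f x - D k) => _ [y Uy <-]; rewrite lerBlDr; exact: SD.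
have cov : `[a, a + l]%classic `<=` \bigcup_k J k.
  move=> t /=; rewrite in_itv/= => /fK[z Kz <-].
  have [k _ Ukz] := KU _ Kz; exists k => //.
  have Sk : S k (f z) by exists z.
  rewrite /J; have -> : meets k by apply/asboolP; exists z.
  rewrite /= in_itv/=; apply/andP; split.
    exact: (ge_inf (S_lb _ _ Ukz)).
  exact: (ub_le_sup (S_ub _ _ Ukz)).
have mJ k : measurable (J k).
  by rewrite /J; case: ifP => _; [exact: measurable_itv|exact: measurable0].
have : (lebesgue_measure (`[a, (a + l)%R]%classic : set R) <=
    \sum_(0 <= k <oo) lebesgue_measure (J k))%E.
  by apply: measure_sigma_subadditive => //; exact: measurable_itv.
rewrite lebesgue_measure_itv/= lte_fin.
have -> : (if a < a + l then ((a + l)%:E - a%:E)%E else 0%E) = l%:E.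
  rewrite ltrDl; case: ltgtP l0 => // [|<-]// _ _.
  by rewrite -EFinB addrAC subrr add0r.
move=> /le_trans; apply; apply: lee_nneseries => k _ //.
rewrite /J -/(meets k); case: ifPn => [/asboolP[z [Uz _]]|_]; last by rewrite measure0.
have Sz : S k (f z) by exists z.
have le_D : sup (S k) - inf (S k) <= D k.
  rewrite lerBlDr -lerBlDl; apply: lb_le_inf; first by exists (f z).
  move=> _ [y Uy <-]; rewrite lerBlDr.
  apply: ge_sup; first by exists (f z).
  by move=> _ [x Ux <-]; exact: SD.
rewrite lebesgue_measure_itv/= lte_fin DE; case: ifP => _.
  by rewrite -EFinB lee_fin.
rewrite lee_fin; apply: le_trans le_D; rewrite subr_ge0.
apply: (@le_trans _ _ (f z)).
  exact: (ge_inf (S_lb _ _ Uz)).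
exact: (ub_le_sup (S_ub _ _ Uz)).
Qed.

(** In a cover by sets of diameter at most [delta], a set meets at most one of
    the [K i], so the lower bounds for the individual [K i] add up. Assuming
    a positive distance between the pieces avoids Caratheodory measurability. *)
Lemma hausdorff_length_separated (I : finType) A (K : I -> set R[i])
    (l : I -> R) (delta : R) :
  0 < delta -> (forall i, 0 <= l i) -> (forall i, wide (K i) (l i)) ->
  (forall i, K i `<=` A) ->
  (forall i j x y, K i x -> K j y -> normc (x - y) <= delta -> i = j) ->
  ((\sum_i l i)%:E <= hausdorff_length A)%E.
Proof.
move=> delta0 l0 wK KA sepK.
apply: (@le_trans _ _ (hausdorff_content delta A)); last first.
  by apply: ereal_sup_ubound; exists delta.
apply: le_ereal_inf_tmp => _ [U [AU Ud] <-].
pose meets k i := `[< U k `&` K i !=set0 >].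
apply: (@le_trans _ _ (\sum_i \sum_(0 <= k <oo) if meets k i then diameter (U k) else 0)%E).
  rewrite -sumEFin; apply: lee_sum => i _.
  apply: (@shadow_cover _ _ delta) => //; split => // z Kz; exact/AU/(KA i).
rewrite -nneseries_sum; last by move=> i k _; case: ifP => // _; exact: diameter_ge0.
apply: lee_nneseries => [k _ _|k _].
  by apply: sume_ge0 => i _; case: ifP => // _; exact: diameter_ge0.
have [[i0 mi0]|nomeet] := pselect (exists i, meets k i); last first.
  rewrite big1 ?diameter_ge0// => i _; case: ifP => // mi.
  by exfalso; apply: nomeet; exists i.
rewrite (bigD1 i0)//= mi0 big1 ?adde0// => i ii0.
case: ifP => // /asboolP[x [Ux Kx]]; move/asboolP: mi0 => [y [Uy Ky]].
suff /eqP : i = i0 by rewrite (negbTE ii0).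
apply: (sepK _ _ x y) => //; rewrite -lee_fin.
exact: le_trans (diameter_ub Ux Uy) (Ud k).
Qed.

End HausdorffBounds.

(** * Auxiliary real and complex estimates *)

Section RealEstimates.
Context {R : realType}.

Lemma inv_sub_bound (u c X D s : R) : 0 < c -> c <= u -> 0 <= X <= c / 2 ->
  0 <= s -> (u - X) * D <= s -> D <= s * (u^-1 + 2 * X / c ^+ 2).
Proof.
move=> c0 cu /andP[X0 Xc] s0 h.
have u0 : 0 < u by lra.
have uX : 0 < u - X by lra.
rewrite -(ler_pM2l uX); apply: le_trans h _.
rewrite mulrCA ler_peMr//.
have -> : (u - X) * (u^-1 + 2 * X / c ^+ 2) =
    1 + X * ((2 * (u - X)) * c ^- 2 - u^-1).
  by field; rewrite ?lt0r_neq0.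
rewrite lerDl; apply: mulr_ge0 => //; rewrite subr_ge0.
rewrite ler_pdivlMr ?exprn_gt0// mulrC ler_pdivrMr//.
nra.
Qed.

Lemma inv_add_bound (u c X : R) : 0 < c -> c <= u -> 0 <= X ->
  u^-1 - X / c ^+ 2 <= (u + X)^-1.
Proof.
move=> c0 cu X0.
have u0 : 0 < u by lra.
have uX : 0 < u + X by lra.
have h : X / u ^+ 2 <= X / c ^+ 2.
  by rewrite ler_wpM2l// lef_pV2 ?posrE ?exprn_gt0// ler_sqr ?nnegrE; lra.
apply: (@le_trans _ _ (u^-1 - X / u ^+ 2)); first by rewrite lerD2l lerN2.
rewrite -[leRHS]div1r ler_pdivlMr//.
have -> : (u^-1 - X / u ^+ 2) * (u + X) = 1 - (X / u) ^+ 2.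
  by field; rewrite lt0r_neq0.
by rewrite gerBl sqr_ge0.
Qed.

Lemma lipschitz_ivt (f : R -> R) (a b M v : R) : a <= b ->
  (forall x y, a <= x <= b -> a <= y <= b -> `|f x - f y| <= M * `|x - y|) ->
  f a <= v <= f b -> exists2 c, a <= c <= b & f c = v.
Proof.
move=> ab lf /andP[av vb].
have fab : Num.min (f a) (f b) <= v <= Num.max (f a) (f b).
  by rewrite ge_min av le_max vb orbT.
suff cf : {within `[a, b], continuous f}.
  by have [c] := IVT ab cf fab; rewrite in_itv/= => cab <-; exists c.
apply/subspace_continuousP => x /=; rewrite in_itv/= => xab.
apply/cvgrPdist_le => e e0.
have M0 : 0 < `|M| + 1 by rewrite ltr_wpDl.
rewrite near_withinE; near=> y => /=; rewrite in_itv/= => yab.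
apply: (le_trans (lf _ _ xab yab)).
apply: (@le_trans _ _ ((`|M| + 1) * (e / (`|M| + 1)))); last first.
  by rewrite mulrCA divff ?mulr1// lt0r_neq0.
apply: (@le_trans _ _ ((`|M| + 1) * `|x - y|)).
  by rewrite ler_wpM2r// (le_trans (ler_norm _))// lerDl.
rewrite ler_pM2l//.
near: y; have e1 : 0 < e / (`|M| + 1) by rewrite divr_gt0.
have xx : (fun y : R => y) @ nbhs x --> x by exact: cvg_id.
move/cvgrPdist_le : xx => /(_ _ e1); exact.
Unshelve. all: by end_near. Qed.

Lemma normc_polar (v : R[i]) : exists2 e : R[i], normc e <= 1 &
  complex.Re (v * e) = normc v.
Proof.
have [->|v0] := eqVneq v 0.
  by exists 0; rewrite ?mul0r normc0.
exists ((normc v)%:C / v); last by rewrite mulrC divfK.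
rewrite normcM normcV.
have -> : normc (normc v)%:C = normc v.
  by rewrite /normc/= expr0n/= addr0 sqrtr_sqr ger0_norm ?normc_ge0.
by rewrite divff// normc_eq0.
Qed.

End RealEstimates.

(** * Riemann sums for the length of a regular lemniscate *)

Section RiemannSums.
Context {R : realType}.
Implicit Types (Q : {poly R[i]}) (t : R).

Definition mesh N : R := pi *+ 2 / N%:R.

Definition node N t0 j : R := t0 + mesh N * j%:R.

Definition speed_sum Q (zeta : R[i]) : R :=
  \sum_(z <- fiber Q zeta) (normc Q^`().[z])^-1.

(** A Riemann sum of the integral, over the unit circle, of the sum of
    [1 / |Q'|] over the preimages by [Q]: by the change of variables given by
    the local inverses of [Q], this integral is the length of the lemniscate.
    The angle [t0] of the first node is a parameter, to be adjusted in
    [riemann_submean]. *)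
Definition riemann_length N t0 Q : R :=
  mesh N * \sum_(j < N) speed_sum Q (expi (node N t0 j)).

Lemma mesh_ge0 N : 0 <= mesh N.
Proof. by rewrite divr_ge0// mulrn_wge0// pi_ge0. Qed.

Lemma meshM N : (0 < N)%N -> mesh N * N%:R = pi *+ 2.
Proof. by move=> N0; rewrite divfK// pnatr_eq0 -lt0n. Qed.

Lemma mesh_gt0 N : (0 < N)%N -> 0 < mesh N.
Proof.
move=> N0; have p0 := pi_gt0 R.
by rewrite divr_gt0 ?ltr0n// mulr2n addr_gt0.
Qed.

Lemma mesh_small (e : R) : 0 < e ->
  exists2 N0, (0 < N0)%N & forall N, (N0 <= N)%N -> mesh N <= e.
Proof.
move=> e0; have p0 : 0 <= pi *+ 2 / e.
  by apply: divr_ge0; [rewrite mulrn_wge0// pi_ge0|exact: ltW].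
exists (Num.truncn (pi *+ 2 / e)).+1 => // N hN.
have N0 : (0 < N)%N by apply: leq_trans hN.
rewrite ler_pdivrMr ?ltr0n// mulrC -ler_pdivrMr//.
apply: le_trans (ltW (truncnS_gt _)) _; by rewrite ler_nat.
Qed.

Section WithData.
Variables (n : nat) (Q : {poly R[i]}) (B c eta rho L : R).
Hypothesis dQ : regular_data n Q B c eta rho L.
Hypothesis n_gt0 : (0 < n)%N.
Variables (N : nat) (t0 : R).
Hypothesis N_gt0 : (0 < N)%N.

Let s := mesh N.
(* a bound for the distance from a point of a cell to the root of the cell *)
Let r := 2 * s / c.

Hypothesis s1 : s <= 1.
Hypothesis srho : s < rho ^+ n.
Hypothesis rrho : 4 * r <= rho.
Hypothesis rL : L * r <= c / 2.

Let cell_root (i : 'I_N * 'I_n) : R[i] := (fiber Q (expi (node N t0 i.1)))`_i.2.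

Lemma speed_sum_pairs :
  riemann_length N t0 Q = \sum_i s * (normc Q^`().[cell_root i])^-1.
Proof.
rewrite /riemann_length -mulr_sumr -(pair_bigA _ (fun (j : 'I_N) (l : 'I_n) =>
  (normc Q^`().[(fiber Q (expi (node N t0 j)))`_l])^-1))/=.
congr (_ * _); apply: eq_bigr => j _.
by rewrite /speed_sum (big_nth 0) (size_fiber dQ n_gt0) big_mkord.
Qed.

Let c0 : 0 < c := rd_c dQ.
Let s0 : 0 < s := mesh_gt0 N_gt0.
Let r0 : 0 < r.
Proof. by rewrite divr_gt0// mulr_gt0. Qed.
Let rr : r <= rho.
Proof. by have := r0; have := rrho; lra. Qed.
Let L0 : 0 <= L := rd_L dQ.
Let Lr0 : 0 <= L * r.
Proof. by apply: mulr_ge0 => //; exact: ltW. Qed.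
Let e0 : 0 <= eta.
Proof. by have /andP[/ltW] := rd_eta dQ. Qed.

Lemma cell_rootE i : Q.[cell_root i] = expi (node N t0 i.1).
Proof.
apply/eqP; rewrite -(mem_fiber dQ n_gt0); apply: mem_nth.
by rewrite (size_fiber dQ n_gt0).
Qed.

Lemma expi_level t z : Q.[z] = expi t -> `|normc Q.[z] - 1| <= eta.
Proof. by move=> ->; rewrite normc_expi subrr normr0. Qed.

Let cell_level i := expi_level (cell_rootE i).

Lemma cell_deriv i : c <= normc Q^`().[cell_root i].
Proof. exact: (rd_deriv dQ (cell_level i)). Qed.

(** The branch, through [cell_root i], of the preimage of an arc of angle [l].
    With [l = mesh N] the cells cover the lemniscate; with a smaller [l] they
    are at a positive distance from each other. *)
Definition cell (i : 'I_N * 'I_n) (l : R) : set R[i] :=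
  [set x | normc (x - cell_root i) <= rho /\
    exists2 t, 0 <= t <= l & Q.[x] = expi (node N t0 i.1 + t)].

Lemma cell_close i l x : l <= s -> cell i l x -> normc (x - cell_root i) <= r.
Proof.
move=> ls [xr [t /andP[t_0 tl] Qx]].
have zr : normc (cell_root i - cell_root i) <= rho.
  by rewrite subrr normc0; have := rr; have := r0; lra.
have := local_expansion dQ (cell_level i) xr zr.
rewrite Qx cell_rootE => /le_trans-/(_ _ (normc_expiB_le _ _)).
rewrite addrAC subrr add0r ger0_norm// => h.
have := le_trans h (le_trans tl ls).
by move=> hs; rewrite /r ler_pdivlMr//; lra.
Qed.

Lemma lemniscate_cell z : lemniscate Q z -> exists i, cell i s z.
Proof.
move=> /eqP; rewrite norm_eq1 => /eqP /(expi_surj t0)[t /andP[t_0 tpi] Qz].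
have ts0 : 0 <= t / s by rewrite divr_ge0// ltW.
pose j := Num.truncn (t / s).
have /andP[jt tj] : j%:R <= t / s < j.+1%:R := truncn_itv ts0.
rewrite ler_pdivlMr// in jt; rewrite ltr_pdivrMr// -natr1 mulrDl mul1r in tj.
have jN : (j < N)%N.
  rewrite -(ltr_nat R) -(ltr_pM2r s0); apply: le_lt_trans jt _.
  by rewrite [_ * s]mulrC /s meshM.
pose tj' := node N t0 j.
have Qz' : Q.[z] = expi (tj' + (t - j%:R * s)).
  by rewrite Qz; congr expi; rewrite /tj' /node -/s; ring.
have tt : 0 <= t - j%:R * s <= s by lra.
have [|x xf xz] := root_close dQ n_gt0 (z := z) (zeta := expi tj').
  rewrite Qz'; apply: le_lt_trans (normc_expiB_le _ _) _.
  rewrite addrAC subrr add0r ger0_norm; first by apply: le_lt_trans srho; lra.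
  lra.
have ix : (index x (fiber Q (expi tj')) < n)%N.
  by rewrite -[X in (_ < X)%N](size_fiber dQ n_gt0 (expi tj')) index_mem.
exists (Ordinal jN, Ordinal ix); split; last by exists (t - j%:R * s).
by rewrite /cell_root/= nth_index// normcB.
Qed.

(** A cell has diameter at most about [s / |Q'|], by almost linearity. *)
Lemma content_le_riemann (delta : R) : r <= delta ->
  (hausdorff_content delta (lemniscate Q) <=
    (riemann_length N t0 Q + pi *+ 2 * n%:R * (2 * L * r / c ^+ 2))%:E)%E.
Proof.
move=> rdelta.
pose u i := normc Q^`().[cell_root i].
have cu i : c <= u i := cell_deriv i.
have X0 : 0 <= 2 * (L * r) / c ^+ 2.
  by apply: divr_ge0; [exact: mulr_ge0|exact: exprn_ge0 (ltW c0)].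
have -> : riemann_length N t0 Q + pi *+ 2 * n%:R * (2 * L * r / c ^+ 2) =
    \sum_i s * ((u i)^-1 + 2 * (L * r) / c ^+ 2).
  under eq_bigr do rewrite mulrDr.
  rewrite big_split -speed_sum_pairs/= sumr_const card_prod !card_ord.
  congr (_ + _); rewrite -(meshM N_gt0) -/s -(mulr_natr (s * _)) natrM; ring.
have d0 i : 0 <= s * ((u i)^-1 + 2 * (L * r) / c ^+ 2).
  apply: mulr_ge0; first exact: ltW.
  by rewrite addr_ge0// invr_ge0 normc_ge0.
apply: (hausdorff_content_finite_cover (V := fun i => cell i s)).
- by apply: le_trans rdelta; exact: ltW.
- exact: lemniscate_cell.
- move=> i; rewrite d0/=; apply: le_trans rdelta.
  have rE : r = s * (c^-1 + c^-1) by rewrite /r; field; rewrite lt0r_neq0.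
  rewrite [leRHS]rE.
  rewrite ler_pM2l// lerD//.
    by rewrite lef_pV2 ?posrE//; apply: lt_le_trans (cu i).
  rewrite ler_pdivrMr ?exprn_gt0//.
  have -> : c^-1 * c ^+ 2 = c by field; rewrite lt0r_neq0.
  by have := rL; lra.
- move=> i x y xi yi.
  have xr := cell_close (lexx _) xi; have yr := cell_close (lexx _) yi.
  apply: inv_sub_bound => //.
  + by rewrite rL Lr0.
  + exact: ltW.
  have zB := near_level_bounded dQ (cell_level i).
  have := linear_lower dQ zB xr yr rr; move/le_trans; apply.
  have [_ [t /andP[t_0 ts] ->]] := xi; have [_ [t' /andP[t'0 ts'] ->]] := yi.
  apply: le_trans (normc_expiB_le _ _) _.
  by rewrite ler_norml; lra.
Qed.

(** A cell contains the continuous curve obtained by lifting the arc through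
    [cell_root i]; the projection on the direction of its chord covers, by the
    intermediate value theorem, an interval as long as the chord, which almost
    linearity compares with the chord of the arc. *)
Lemma cell_wide i (sg : R) : 0 <= sg <= s ->
  wide (cell i sg) (sg * (1 - sg ^+ 2) / (normc Q^`().[cell_root i] + L * r)).
Proof.
move=> /andP[sg0 sgs]; pose z := cell_root i; pose tj := node N t0 i.1.
have Qz : Q.[z] = expi tj := cell_rootE i.
have ztz : normc (z - z) <= rho by rewrite subrr normc0; apply: ltW; apply: lt_le_trans rr.
have /choice[g hg] : forall t, exists x, 0 <= t <= sg ->
    Q.[x] = expi (tj + t) /\ normc (x - z) <= rho.
  move=> t; case: (boolP (0 <= t <= sg)) => [/andP[t_0 tsg]|_]; last by exists 0.
  have [||x [_ Qx xz _]] := local_inverse dQ n_gt0 (z := z) (zeta := expi (tj + t)).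
  - exact: expi_level Qz.
  - rewrite Qz; apply: le_lt_trans (normc_expiB_le _ _) _.
    rewrite opprD addrA subrr add0r normrN ger0_norm//.
    by apply: le_lt_trans srho; exact: le_trans tsg sgs.
  - by exists x.
have sg1 : 0 <= sg <= sg by rewrite sg0 lexx.
have sg2 : 0 <= (0 : R) <= sg by rewrite sg0 lexx.
have g0 : g 0 = z.
  have [Q0 z0] := hg _ sg2.
  by apply: (local_injective dQ (cell_level i)) => //; rewrite Q0 addr0.
have [Qb bz] := hg _ sg1.
have br : normc (g sg - z) <= r.
  by apply: (@cell_close i sg) => //; split => //; exists sg.
have [e e1 be] := normc_polar (g sg - z).
pose f x := complex.Re ((x - z) * e).
(* [f] is the projection on the direction of the chord, sending its ends to 0
   and to the length of the chord *)
have fne : nonexpansive f.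
  move=> x y; have -> : f x - f y = complex.Re ((x - y) * e).
    rewrite /f -(raddfB (@complex.Re R : {additive R[i] -> R})) -mulrBl.
    by congr (complex.Re (_ * _)); ring.
  apply: le_trans (ler_Re_normc _) _.
  by rewrite normcM ler_piMr// normc_ge0.
exists f, 0; split => // t; rewrite add0r => /andP[t_0 tl].
have [||x xsg <-] := @lipschitz_ivt R (f \o g) 0 sg (2 / c) t sg0.
- move=> x y xsg ysg; apply: le_trans (fne _ _) _.
  have [Qx xz] := hg _ xsg; have [Qy yz] := hg _ ysg.
  have := local_expansion dQ (cell_level i) xz yz.
  rewrite Qx Qy => /le_trans-/(_ _ (normc_expiB_le _ _)).
  have -> : tj + x - (tj + y) = x - y by ring.
  move=> h; have -> : normc (g x - g y) = 2 / c * (c / 2 * normc (g x - g y)).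
    by field; rewrite lt0r_neq0.
  by rewrite ler_wpM2l// divr_ge0// ltW.
- rewrite /= /f g0 subrr mul0r be t_0/=; apply: le_trans tl _.
  have u0 : 0 < normc Q^`().[z] + L * r.
    by rewrite ltr_pwDl//; apply: lt_le_trans (cell_deriv i).
  rewrite ler_pdivrMr//.
  have := linear_upper dQ (near_level_bounded dQ (cell_level i)) br _ rr.
  move=> /(_ z); rewrite -/z subrr normc0 => /(_ (ltW r0)).
  rewrite Qb Qz [_ * normc _]mulrC; apply: le_trans.
  exact: normc_expiB_ge.
exists (g x) => //; have [Qx xz] := hg _ xsg.
by split => //; exists x.
Qed.

(** Cells over different nodes are separated because their images are: the
    angles of two such images differ by at least [gap] modulo a full turn.
    Cells over the same node are small compared with the distance between two
    roots, which local injectivity bounds from below by [rho]. *)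
Lemma cells_separated (sg : R) : 0 <= sg < s -> exists2 d : R, 0 < d &
  forall i j x y, cell i sg x -> cell j sg y -> normc (x - y) <= d -> i = j.
Proof.
move=> /andP[sg0 sgs].
pose gap := s - sg.
have gap0 : 0 < gap by rewrite subr_gt0.
pose sep (k l : 'I_N) (t t' : R) :=
  normc (expi (node N t0 k + t) - expi (node N t0 l + t')).
have far (k l : 'I_N) t t' : (k < l)%N -> 0 <= t <= sg -> 0 <= t' <= sg ->
    2 - 2 * cos gap <= sep k l t t' ^+ 2 /\ 0 < 2 - 2 * cos gap.
  move=> kl /andP[t_0 tsg] /andP[t'_0 t'sg]; apply: normc_expiB_sep => //.
  have -> : node N t0 k + t - (node N t0 l + t') =
      - (s * (l - k)%:R + t' - t).
    by rewrite natrB ?(ltnW kl)// /node -/s; ring.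
  have lk1 : s <= s * (l - k)%:R.
    by rewrite -[leLHS]mulr1 ler_pM2l// ler1n subn_gt0.
  have lkN : s * (l - k)%:R <= pi *+ 2 - s.
    have -> : pi *+ 2 - s = s * (N.-1)%:R.
      by rewrite -(meshM N_gt0) -/s -[in LHS](prednK N_gt0) -natr1; ring.
    rewrite ler_pM2l// ler_nat -ltnS (prednK N_gt0).
    by apply: leq_ltn_trans (ltn_ord l); exact: leq_subr.
  by rewrite normrN ger0_norm /gap; lra.
pose m := Num.sqrt (2 - 2 * cos gap).
have m0 : 0 < 2 - 2 * cos gap.
  have gap_pi : gap <= pi.
    have := pi_ge2 R; have := s1; rewrite /gap; lra.
  have : cos gap < 1 by rewrite -[X in _ < X]cos0 ltr_cos ?in_itv/= ?lexx; lra.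
  lra.
have m_gt0 : 0 < m by rewrite sqrtr_gt0.
have far' (k l : 'I_N) t t' : k != l -> 0 <= t <= sg -> 0 <= t' <= sg ->
    m <= sep k l t t'.
  move=> kl ht ht'; rewrite -(@ler_sqr _ m) ?nnegrE ?normc_ge0 ?(ltW m_gt0)//.
  rewrite sqr_sqrtr ?(ltW m0)//.
  have [klt|klt] := ltnP k l; first by have [] := far _ _ _ _ klt ht ht'.
  rewrite /sep normcB; have [] := far l k t' t _ ht' ht => //.
  by rewrite ltn_neqAle klt andbT eq_sym.
exists (Num.min (m / (2 * (L + 1))) r) => [|i j x y xi yj].
  by rewrite lt_min r0 andbT divr_gt0// mulr_gt0// ltr_wpDl.
rewrite le_min => /andP[xym xyr].
have xz := cell_close (ltW sgs) xi; have yz := cell_close (ltW sgs) yj.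
move: xi yj => [_ [t ht Qx]] [_ [t' ht' Qy]].
have xB := near_level_bounded dQ (expi_level Qx).
have yB := near_level_bounded dQ (expi_level Qy).
have eqj : i.1 = j.1.
  apply/eqP/negPn/negP => /far'/(_ ht ht').
  rewrite /sep -Qx -Qy leNgt => /negP; apply.
  apply: le_lt_trans (rd_lipschitz dQ _ _) _; [lra|lra|].
  apply: (@le_lt_trans _ _ ((L + 1) * (m / (2 * (L + 1))))).
    by apply: ler_pM => //; [exact: normc_ge0|rewrite lerDl].
  have -> : (L + 1) * (m / (2 * (L + 1))) = m / 2.
    by field; rewrite lt0r_neq0// ltr_wpDl.
  lra.
have zz : normc (cell_root j - cell_root i) <= rho.
  apply: le_trans (normc_triangle y _ _) _.
  have := normc_triangle x y (cell_root i).
  rewrite (normcB y) in yz; rewrite (normcB y x); have := rrho; have := r0; lra.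
have zi : normc (cell_root i - cell_root i) <= rho.
  by rewrite subrr normc0; apply: ltW; apply: lt_le_trans rr.
have ez : cell_root j = cell_root i.
  by apply: (local_injective dQ (cell_level i) zz zi); rewrite !cell_rootE eqj.
have eql : i.2 = j.2.
  apply/val_inj/eqP; move/eqP: ez; rewrite /cell_root eqj.
  rewrite nth_uniq ?(size_fiber dQ n_gt0)// 1?eq_sym//.
  by apply: (uniq_fiber dQ n_gt0); rewrite normc_expi subrr normr0.
by rewrite (surjective_pairing i) (surjective_pairing j) eqj eql.
Qed.

(** The parameter [e] is the proportion by which the cells are shortened in
    order to separate them. *)
Lemma riemann_le_length (e : R) : 0 < e <= 1 ->
  ((riemann_length N t0 Q - pi *+ 2 * n%:R * (e / c + s / c + L * r / c ^+ 2))%:E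
    <= hausdorff_length (lemniscate Q))%E.
Proof.
move=> /andP[e_0 e_1].
pose sg := (1 - e) * s.
have sg0 : 0 <= sg by rewrite mulr_ge0 ?subr_ge0// ltW.
have sgs : sg < s by rewrite /sg mulrBl mul1r gtrDl oppr_lt0 mulr_gt0.
pose u i := normc Q^`().[cell_root i].
have cu i : c <= u i := cell_deriv i.
pose l i := sg * (1 - sg ^+ 2) / (u i + L * r).
have sgsq : sg ^+ 2 <= s.
  rewrite expr2; apply: (@le_trans _ _ (s * 1)); last by rewrite mulr1.
  by apply: ler_pM => //; rewrite ltW// (lt_le_trans sgs).
have sg1 : 0 <= 1 - sg ^+ 2 by rewrite subr_ge0 (le_trans sgsq).
have uL0 i : 0 < u i + L * r by rewrite ltr_pwDl//; apply: lt_le_trans (cu i).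
have l0 i : 0 <= l i.
  by apply: divr_ge0; [exact: mulr_ge0|exact: ltW].
have [|d d0 sep] := @cells_separated sg; first by rewrite sg0.
apply: le_trans (hausdorff_length_separated (K := fun i => cell i sg) d0 l0 _ _ sep).
- rewrite lee_fin.
  have -> : riemann_length N t0 Q - pi *+ 2 * n%:R * (e / c + s / c + L * r / c ^+ 2)
    = \sum_i (s * (u i)^-1 - s * (e / c + s / c + L * r / c ^+ 2)).
    rewrite big_split -speed_sum_pairs/= sumr_const card_prod !card_ord.
    congr (_ + _); rewrite -(meshM N_gt0) -/s -(mulr_natr (- _)) natrM; ring.
  apply: ler_sum => i _.
  have h1 := inv_add_bound c0 (cu i) Lr0.
  have h2 : (u i + L * r)^-1 <= c^-1.
    by rewrite lef_pV2 ?posrE// ler_wpDr// cu.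
  rewrite /l; move: (u i + L * r)^-1 h1 h2 => v h1 h2.
  have v0 : s * (u i)^-1 - s * (L * r / c ^+ 2) <= s * v.
    by rewrite -mulrBr ler_wpM2l// ltW.
  have m0 : 0 <= s - sg * (1 - sg ^+ 2) <= s * (e + s).
    have h3 : e * (s * sg ^+ 2) <= s * sg ^+ 2.
      by rewrite ler_piMl// mulr_ge0 ?sqr_ge0// ltW.
    have h4 : s * sg ^+ 2 <= s * s by rewrite ler_wpM2l// ltW.
    have h5 : sg * sg ^+ 2 = s * sg ^+ 2 - e * (s * sg ^+ 2) by rewrite {1}/sg; ring.
    have h6 : 0 <= e * s by apply: mulr_ge0; exact: ltW.
    have h7 : 0 <= e * (s * sg ^+ 2) by apply: mulr_ge0; [exact: ltW|apply: mulr_ge0; [exact: ltW|exact: sqr_ge0]].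
    have h8 : sg = s - e * s by rewrite /sg; ring.
    rewrite mulrBr mulr1 h5 [s * (e + s)]mulrDr [s * e]mulrC; move: h3 h4 h6 h7 h8.
    move: (e * (s * sg ^+ 2)) (s * sg ^+ 2) (e * s) => a b d'.
    by move=> *; apply/andP; split; lra.
  have : (s - sg * (1 - sg ^+ 2)) * v <= s * (e + s) * c^-1.
    have /andP[m1 m2] := m0.
    apply: le_trans (ler_wpM2l m1 h2) _.
    by rewrite ler_wpM2r// invr_ge0 ltW.
  lra.
- by move=> i; apply: cell_wide; rewrite sg0 ltW.
- move=> i x [_ [t _ Qx]]; rewrite /lemniscate/=.
  by apply/eqP; rewrite norm_eq1 Qx normc_expi.
Qed.

End WithData.
End RiemannSums.

(** * Convergence of the Riemann sums to the length *)

Section LengthLimit.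
Context {R : realType}.
Implicit Types (Q : {poly R[i]}).

(** Solves simultaneously finitely many requirements of the form [a * s <= b] on
    a small positive [s]. *)
Lemma small_enough (conds : seq (R * R)) :
  all (fun ab => (0 <= ab.1) && (0 < ab.2)) conds ->
  exists2 s0 : R, 0 < s0 &
    forall s, 0 <= s <= s0 -> all (fun ab => ab.1 * s <= ab.2) conds.
Proof.
elim: conds => [|[a b] l IH] /=; first by exists 1.
move=> /andP[/andP[/= a0 b0] /IH[s0 s00 hs0]].
have a1 : 0 < a + 1 by rewrite ltr_wpDl.
exists (Num.min s0 (b / (a + 1))) => [|s]; first by rewrite lt_min s00 divr_gt0.
rewrite le_min => /and3P[s_0 ss0 sb]; rewrite hs0 ?s_0 ?andbT//.
rewrite ler_pdivlMr// in sb; lra.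
Qed.

Section WithData.
Variables (n : nat) (Q : {poly R[i]}) (B c eta rho L : R).
Hypothesis dQ : regular_data n Q B c eta rho L.
Hypothesis n_gt0 : (0 < n)%N.

Let c0 : 0 < c := rd_c dQ.
Let rho0 : 0 < rho.
Proof. by have /andP[] := rd_rho dQ. Qed.
Let L0 : 0 <= L := rd_L dQ.

Let divc_ge0 (a : R) : 0 <= a -> 0 <= a / c.
Proof. by move=> a0; apply: divr_ge0 => //; exact: ltW. Qed.

Lemma riemann_upper t0 (e delta : R) : 0 < e -> 0 < delta ->
  exists2 N0, (0 < N0)%N & forall N, (N0 <= N)%N ->
    (hausdorff_content delta (lemniscate Q) <= (riemann_length N t0 Q + e)%:E)%E.
Proof.
move=> e0 d0.
pose C1 := pi *+ 2 * n%:R * (2 * L * (2 / c) / c ^+ 2).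
have p0 : 0 <= pi *+ 2 :> R by rewrite mulrn_wge0// pi_ge0.
have C10 : 0 <= C1.
  by rewrite /C1 !mulr_ge0// ?invr_ge0 ?exprn_ge0// ltW.
have [|s0 s00 hs] := @small_enough [:: (1, 1); (2, rho ^+ n); (8 / c, rho);
    (2 * L / c, c / 2); (2 / c, delta); (C1, e)].
  have Lc : 0 <= 2 * L by exact: mulr_ge0.
  by rewrite /= C10 e0 d0 rho0 exprn_gt0// ltr01 ler01 ler0n !divc_ge0// divr_gt0.
have [N0 N00 hN] := mesh_small s00.
exists N0 => // N NN0; have N_0 : (0 < N)%N by apply: leq_trans NN0.
have m0 := mesh_gt0 (R := R) N_0.
have := hs (mesh N); rewrite (ltW m0) hN// => /(_ isT).
rewrite /= andbT => /and5P[h1 h2 h3 h4 /andP[h5 h6]].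
apply: le_trans (content_le_riemann dQ n_gt0 t0 N_0 _ _ _ _) _.
- by apply: lt_le_trans h2; lra.
- by apply: le_trans h3; rewrite le_eqVlt; apply/orP; left; apply/eqP; ring.
- by apply: le_trans h4; rewrite le_eqVlt; apply/orP; left; apply/eqP; ring.
- by apply: le_trans h5; rewrite le_eqVlt; apply/orP; left; apply/eqP; ring.
rewrite lee_fin lerD2l; apply: le_trans h6.
by rewrite le_eqVlt; apply/orP; left; apply/eqP; rewrite /C1; ring.
Qed.

Lemma riemann_lower t0 (e : R) : 0 < e ->
  exists2 N0, (0 < N0)%N & forall N, (N0 <= N)%N ->
    ((riemann_length N t0 Q - e)%:E <= hausdorff_length (lemniscate Q))%E.
Proof.
move=> e0.
have p0 : 0 <= pi *+ 2 :> R by rewrite mulrn_wge0// pi_ge0.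
have [|e1 e10 he1] := @small_enough [:: (1, 1); (pi *+ 2 * n%:R / c, e / 2)].
  by rewrite /= ltr01 ler01 divc_ge0 ?divr_gt0// mulr_ge0.
pose C1 := pi *+ 2 * n%:R * (c^-1 + L * (2 / c) / c ^+ 2).
have C10 : 0 <= C1.
  apply: mulr_ge0; first by rewrite mulr_ge0.
  by rewrite addr_ge0// ?divr_ge0 ?mulr_ge0 ?invr_ge0 ?exprn_ge0// ltW.
have [|s0 s00 hs] := @small_enough [:: (1, 1); (2, rho ^+ n); (8 / c, rho);
    (C1, e / 2)].
  by rewrite /= C10 rho0 exprn_gt0// ltr01 ler01 ler0n !divc_ge0// !divr_gt0.
have [N0 N00 hN] := mesh_small s00.
exists N0 => // N NN0; have N_0 : (0 < N)%N by apply: leq_trans NN0.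
have m0 := mesh_gt0 (R := R) N_0.
have := hs (mesh N); rewrite (ltW m0) hN// => /(_ isT).
rewrite /= andbT => /and4P[h1 h2 h3 h5].
have := he1 e1; rewrite lexx (ltW e10) => /(_ isT) /=.
rewrite andbT => /andP[k1 k2].
apply: le_trans (riemann_le_length dQ n_gt0 t0 N_0 _ _ _ (e := e1) _).
- rewrite lee_fin lerD2l lerN2.
  have -> : pi *+ 2 * n%:R * (e1 / c + mesh N / c + L * (2 * mesh N / c) / c ^+ 2)
    = pi *+ 2 * n%:R / c * e1 + C1 * mesh N by rewrite /C1; ring.
  lra.
- by rewrite -(mul1r (mesh N)).
- by apply: lt_le_trans h2; lra.
- by apply: le_trans h3; rewrite le_eqVlt; apply/orP; left; apply/eqP; ring.
- by rewrite e10 -(mul1r e1).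
Qed.

Lemma riemann_length_le N t0 : (0 < N)%N ->
  riemann_length N t0 Q <= pi *+ 2 * n%:R / c.
Proof.
move=> N0.
have -> : pi *+ 2 * n%:R / c = mesh N * \sum_(j < N) (n%:R / c).
  by rewrite sumr_const card_ord -[_ *+ N]mulr_natl -(meshM N0); ring.
rewrite ler_pM2l ?mesh_gt0//.
apply: ler_sum => j _; rewrite /speed_sum big_seq.
apply: (@le_trans _ _ (\sum_(z <- fiber Q (expi (node N t0 j)) |
    z \in fiber Q (expi (node N t0 j))) c^-1)).
  apply: ler_sum => z; rewrite (mem_fiber dQ n_gt0) => /eqP/(expi_level dQ).
  move=> /(rd_deriv dQ) cz.
  by rewrite lef_pV2 ?posrE// (lt_le_trans _ cz).
rewrite -big_seq big_const_seq count_predT (size_fiber dQ n_gt0).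
by rewrite iter_addr addr0 mulr_natl.
Qed.

End WithData.
End LengthLimit.

(** * Strict subharmonicity of the reciprocal of the derivative *)

Section InverseExpansion.
Context {R : realType}.
Implicit Types (P : {poly R[i]}) (z u w : R[i]).

(** The quadratic gain in the imaginary part, orthogonal to the direction of 1,
    is what makes the modulus of a nonconstant holomorphic function strictly
    subharmonic. *)
Lemma normc_1D_ge (x : R[i]) : normc x <= 1 / 2 ->
  1 + complex.Re x + complex.Im x ^+ 2 / 4 <= normc (1 + x).
Proof.
move=> x2; have hr := le_trans (ler_Re_normc x) x2.
have hi := le_trans (ler_Im_normc x) x2.
rewrite -ler_sqr ?nnegrE ?normc_ge0//; last first.
  rewrite addr_ge0 ?divr_ge0 ?sqr_ge0//.
  by move: hr; rewrite ler_norml; lra.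
rewrite normc_sqr; case: x hr hi {x2} => a b /=; rewrite add0r !ler_norml => hr hi.
have b2 : b ^+ 2 <= 1 by rewrite expr2; nra.
have b20 := sqr_ge0 b; nra.
Qed.

Definition nderiv2 P z := P^`N(2).[z].
(** When [P.[z + u] = P.[z] + w], the quotient [P'(z) / P'(z + u)] is a power
    series [1 + recip_coef1 P z * w + recip_coef2 P z * w ^+ 2 + ...] in [w];
    the coefficients are found by substituting the expansions in [u]. *)
Definition recip_coef1 P z : R[i] := - (2 * nderiv2 P z) / P^`().[z] ^+ 2.
Definition recip_coef2 P z : R[i] :=
  (6 * nderiv2 P z ^+ 2 / P^`().[z] - P^`()^`N(2).[z]) / P^`().[z] ^+ 3.

Lemma deriv_nderivn1 P z : P^`()^`N(1).[z] = 2 * nderiv2 P z.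
Proof.
rewrite nderivn1 /nderiv2.
have -> : P^`()^`() = P^`(2) by [].
by rewrite nderivn_def hornerMn mulr_natl.
Qed.

(** The cofactor of [u ^+ 3] left when the expansion is cut after [w ^+ 2];
    here [w] is [u * (p1 + u * m)], and [1 + A1 * u + A2 * u ^+ 2 + u ^+ 3 * A3]
    is the truncated expansion rewritten in [u]. *)
Definition expansion_error P z u : R[i] :=
  let p1 := P^`().[z] in let a := nderiv2 P z in let b := P^`()^`N(2).[z] in
  let s1 := taylor_rem 3 P^`() z u in let s2 := taylor_rem 3 P z u in
  let m := a + u * s2 in
  let A1 := - (2 * a) / p1 in
  let A2 := recip_coef1 P z * a + recip_coef2 P z * p1 ^+ 2 in
  let A3 := recip_coef1 P z * s2 + 2 * (recip_coef2 P z * p1 * m) + u * recip_coef2 P z * m ^+ 2 in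
  s1 * (1 + A1 * u + A2 * u ^+ 2 + u ^+ 3 * A3) + (p1 + 2 * a * u + b * u ^+ 2) * A3
    + (2 * a * A2 + b * A1) + u * b * A2.

Lemma inverse_expansion P z u w : P^`().[z] != 0 -> P.[z + u] = P.[z] + w ->
  P^`().[z + u] * (1 + recip_coef1 P z * w + recip_coef2 P z * w ^+ 2) - P^`().[z] =
    u ^+ 3 * expansion_error P z u.
Proof.
move=> p0.
rewrite (taylor_expansion 3 P) (taylor_expansion 3 P^`()).
rewrite !big_ord_recr !big_ord0/= !nderivn0 deriv_nderivn1 nderivn1.
rewrite -/(nderiv2 P z) => hw.
have -> : w = P^`().[z] * u + nderiv2 P z * u ^+ 2 + u ^+ 3 * taylor_rem 3 P z u.
  apply: (addrI P.[z]); rewrite -hw; ring.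
rewrite /expansion_error/= /recip_coef1 /recip_coef2.
by field; exact: p0.
Qed.

Section WithData.
Variables (n : nat) (P : {poly R[i]}) (B c eta rho L : R).
Hypothesis dP : regular_data n P B c eta rho L.
Hypothesis n_gt0 : (0 < n)%N.

Let c0 : 0 < c := rd_c dP.

Let D : set (R[i] * R[i]) :=
  [set t | `|normc P.[t.1] - 1| <= eta /\ normc t.2 <= 1].

Let bsnd : bounded_fct D snd.
Proof. by exists 1 => t []. Qed.
Let bfst_horner (q : {poly R[i]}) : bounded_fct D (fun t => q.[t.1]).
Proof. by apply: bounded_fct_horner; exists B => t [/(near_level_bounded dP)]. Qed.
Let brem k q : bounded_fct D (fun t => taylor_rem k q t.1 t.2).
Proof.
apply: bounded_fct_sum => i; apply: bounded_fctM; first exact: bfst_horner.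
exact: bounded_fctX.
Qed.
Let binv : bounded_fct D (fun t => (P^`().[t.1])^-1).
Proof. by apply: (bounded_fctV c0) => t [/(rd_deriv dP)]. Qed.
Let binvX k : bounded_fct D (fun t => (P^`().[t.1] ^+ k)^-1).
Proof.
have [M hM] := bounded_fctX k binv; exists M => t /hM; by rewrite exprVn.
Qed.
Let bquad : bounded_fct D (fun t => nderiv2 P t.1).
Proof. exact: bfst_horner. Qed.
Let bcst (a : R[i]) : bounded_fct D (fun=> a).
Proof. exact: bounded_fct_cst. Qed.

Let balpha : bounded_fct D (fun t => recip_coef1 P t.1).
Proof.
apply: bounded_fctM; last exact: binvX.
by apply: bounded_fctN; exact: bounded_fctM.
Qed.
Let bbeta : bounded_fct D (fun t => recip_coef2 P t.1).
Proof.
apply: bounded_fctM; last exact: binvX.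
apply: bounded_fctD; last by apply: bounded_fctN; exact: bfst_horner.
by apply: bounded_fctM => //; apply: bounded_fctM => //; exact: bounded_fctX.
Qed.

Lemma bounded_expansion_error :
  bounded_fct D (fun t => expansion_error P t.1 t.2).
Proof.
pose p1 (t : R[i] * R[i]) := P^`().[t.1]; pose a (t : R[i] * R[i]) := nderiv2 P t.1.
pose b (t : R[i] * R[i]) := P^`()^`N(2).[t.1].
pose s1 (t : R[i] * R[i]) := taylor_rem 3 P^`() t.1 t.2; pose s2 (t : R[i] * R[i]) := taylor_rem 3 P t.1 t.2.
pose u (t : R[i] * R[i]) := t.2.
pose m (t : R[i] * R[i]) := a t + u t * s2 t.
pose A1 (t : R[i] * R[i]) := - (2 * a t) / p1 t.
pose A2 (t : R[i] * R[i]) := recip_coef1 P t.1 * a t + recip_coef2 P t.1 * p1 t ^+ 2.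
pose A3 (t : R[i] * R[i]) := recip_coef1 P t.1 * s2 t + 2 * (recip_coef2 P t.1 * p1 t * m t)
  + u t * recip_coef2 P t.1 * m t ^+ 2.
have bp1 : bounded_fct D p1 by exact: bfst_horner.
have ba : bounded_fct D a := bquad.
have bb : bounded_fct D b by exact: bfst_horner.
have bs1 : bounded_fct D s1 := brem _ _.
have bs2 : bounded_fct D s2 := brem _ _.
have bu : bounded_fct D u := bsnd.
have bm : bounded_fct D m := bounded_fctD ba (bounded_fctM bu bs2).
have b2a : bounded_fct D (fun t => 2 * a t) := bounded_fctM (bcst _) ba.
have bA1 : bounded_fct D A1 := bounded_fctM (bounded_fctN b2a) binv.
have bA2 : bounded_fct D A2 := bounded_fctD (bounded_fctM balpha ba)
  (bounded_fctM bbeta (bounded_fctX 2 bp1)).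
have bA3 : bounded_fct D A3 := bounded_fctD (bounded_fctD (bounded_fctM balpha bs2)
  (bounded_fctM (bcst _) (bounded_fctM (bounded_fctM bbeta bp1) bm)))
  (bounded_fctM (bounded_fctM bu bbeta) (bounded_fctX 2 bm)).
exact: bounded_fctD (bounded_fctD (bounded_fctD
  (bounded_fctM bs1 (bounded_fctD (bounded_fctD (bounded_fctD (bcst 1)
    (bounded_fctM bA1 bu)) (bounded_fctM bA2 (bounded_fctX 2 bu)))
    (bounded_fctM (bounded_fctX 3 bu) bA3)))
  (bounded_fctM (bounded_fctD (bounded_fctD bp1 (bounded_fctM b2a bu))
    (bounded_fctM bb (bounded_fctX 2 bu))) bA3))
  (bounded_fctD (bounded_fctM b2a bA2) (bounded_fctM bb bA1)))
  (bounded_fctM (bounded_fctM bu bb) bA2).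
Qed.

Let eta1 : 0 < eta <= 1 := rd_eta dP.

(** Averages over these four points kill the terms in [w] and [w ^+ 2] of an
    expansion, as averages over the whole circle of radius [r] do. *)
Definition compass (r : R) (k : 'I_4) : R[i] := r%:C * 'i ^+ k.

Lemma normc_real (r : R) : 0 <= r -> normc r%:C = r.
Proof. by move=> r0; rewrite /normc/= expr0n/= addr0 sqrtr_sqr ger0_norm. Qed.

Lemma normc_i : normc ('i : R[i]) = 1.
Proof. by rewrite /normc/= expr0n/= add0r expr1n sqrtr1. Qed.

Lemma normc_compass r k : 0 <= r -> normc (compass r k) = r.
Proof. by move=> r0; rewrite /compass normcM normcXn normc_i expr1n mulr1 normc_real. Qed.

Lemma ReM (x y : R[i]) :
  complex.Re (x * y) = complex.Re x * complex.Re y - complex.Im x * complex.Im y.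
Proof. by case: x => a b; case: y. Qed.

Lemma ImM (x y : R[i]) :
  complex.Im (x * y) = complex.Re x * complex.Im y + complex.Im x * complex.Re y.
Proof. by case: x => a b; case: y. Qed.

Lemma sum_compass r (f : R[i] -> R) : \sum_k f (compass r k)
  = f (r +i* 0) + f (0 +i* r) + f (- r +i* 0) + f (0 +i* - r).
Proof.
rewrite !big_ord_recr big_ord0/= add0r /compass/=.
have i2 : ('i : R[i]) ^+ 2 = -1 := sqr_i R.
have i3 : ('i : R[i]) ^+ 3 = - 'i by rewrite exprS i2 mulrN1.
rewrite expr0 expr1 i2 i3 mulr1 !mulrN mulr1.
have -> : (r%:C : R[i]) * 'i = 0 +i* r by simpc.
by congr (f _ + f _ + f _ + f _); rewrite /GRing.opp/= ?oppr0.
Qed.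

Lemma compass_sum r (x : R[i]) : \sum_k complex.Re (x * compass r k) = 0.
Proof.
rewrite (sum_compass r (fun y => complex.Re (x * y))).
by rewrite !ReM /=; ring.
Qed.

Lemma compass_sum_sqr r (x : R[i]) : \sum_k complex.Re (x * compass r k ^+ 2) = 0.
Proof.
rewrite (sum_compass r (fun y => complex.Re (x * y ^+ 2))).
by rewrite !ReM !ImM /=; ring.
Qed.

Lemma compass_sum_Im r (x : R[i]) :
  \sum_k complex.Im (x * compass r k) ^+ 2 = 2 * r ^+ 2 * normc x ^+ 2.
Proof.
rewrite (sum_compass r (fun y => complex.Im (x * y) ^+ 2)).
by rewrite !ImM /= normc_sqr; ring.
Qed.

(** The mean value inequality for [1 / |P'|] read in the coordinate [P], with a
    gain of second order. In the expansion of [P'(z) / P'(x k)], the terms of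
    order 1 and 2 have real parts of mean zero, and the squared imaginary part
    of the term of order 1 has a mean proportional to the squared modulus of
    [recip_coef1 P z], hence to that of [nderiv2 P z]. *)
Lemma pointwise_submean : exists kappa C r1 : R, [/\ 0 < kappa, 0 < C, 0 < r1 &
  forall z r (x : 'I_4 -> R[i]), normc P.[z] = 1 -> 0 < r <= r1 ->
    (forall k, P.[x k] = P.[z] + compass r k) ->
    (forall k, normc (x k - z) <= 2 / c * r) ->
    4 * (normc P^`().[z])^-1 + kappa * r ^+ 2 * normc (nderiv2 P z) ^+ 2 - C * r ^+ 3
    <= \sum_k (normc P^`().[x k])^-1].
Proof.
have [M1 M11 hE] := bounded_fct_max bounded_expansion_error.
have [M2 M21 halpha] := bounded_fct_max balpha.
have [M3 M31 hbeta] := bounded_fct_max bbeta.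
have [M4 M41 hp1] := bounded_fct_max (bfst_horner P^`()).
pose C1 := (2 / c) ^+ 3 * M1 / c.
have C10 : 0 <= C1.
  by rewrite /C1 !mulr_ge0 ?exprn_ge0 ?invr_ge0 ?mulr_ge0 ?invr_ge0 ?(ltW c0)//; lra.
pose C2 := 4 * C1 + 2 * M2 * (M3 + C1).
have C20 : 0 < C2.
  have : 0 < M2 * (M3 + C1) by rewrite mulr_gt0//; lra.
  rewrite /C2; lra.
have [|r1 r10 hr1] := @small_enough R [:: (1, 1); (1, eta); (2 / c, 1); (M2 + M3 + C1, 1 / 2)].
  have /andP[eta0 _] := eta1.
  have M0 : 0 <= M2 + M3 + C1 by lra.
  have c20 : 0 <= 2 / c by apply: divr_ge0 => //; exact: ltW.
  by rewrite /= ltr01 ler01 eta0 M0 c20 divr_gt0.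
exists (2 / M4 ^+ 5), (C2 / c), r1.
have M4_gt0 : 0 < M4 by lra.
split=> //; try by rewrite divr_gt0 ?exprn_gt0.
move=> z r x Pz /andP[r0 rr1] Px xz.
have := hr1 r; rewrite (ltW r0) rr1 => /(_ isT) /=.
rewrite andbT => /and4P[ra rb rc rd].
have zlev : `|normc P.[z] - 1| <= eta.
  by rewrite Pz subrr normr0; have /andP[/ltW] := eta1.
have Dz k : D (z, x k - z).
  by split => //=; apply: le_trans (xz k) rc.
have xlev k : `|normc P.[x k] - 1| <= eta.
  rewrite -Pz; apply: le_trans (ler_dist_normc _ _) _.
  by rewrite Px addrAC subrr add0r normc_compass ?(ltW r0)// -(mul1r r).
pose p1 := P^`().[z]; pose u := normc p1.
have cu : c <= u := rd_deriv dP zlev.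
have u0 : 0 < u by exact: lt_le_trans cu.
have p10 : p1 != 0 by rewrite -normc_gt0.
have uM4 : u <= M4 := hp1 _ (Dz ord0).
pose al := recip_coef1 P z; pose be := recip_coef2 P z.
have alM : normc al <= M2 := halpha _ (Dz ord0).
have beM : normc be <= M3 := hbeta _ (Dz ord0).
pose w k := compass r k.
have nw k : normc (w k) = r by rewrite normc_compass// ltW.
pose X k := p1 / P^`().[x k] - 1.
pose er k := X k - al * w k - be * w k ^+ 2.
have er_le k : normc (er k) <= C1 * r ^+ 3.
  have ck := rd_deriv dP (xlev k).
  have q0 : P^`().[x k] != 0 by rewrite -normc_gt0; apply: lt_le_trans ck.
  have zx : z + (x k - z) = x k by rewrite addrC subrK.
  have hz : P.[z + (x k - z)] = P.[z] + w k by rewrite zx Px.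
  have he := inverse_expansion p10 hz; rewrite zx in he.
  have -> : er k = - ((x k - z) ^+ 3 * expansion_error P z (x k - z)) / P^`().[x k].
    by rewrite -he /er /X -/p1 -/al -/be; field.
  rewrite normcM normc_opp normcM normcV normcXn.
  have -> : C1 * r ^+ 3 = (2 / c * r) ^+ 3 * M1 / c by rewrite /C1; ring.
  apply: ler_pM; rewrite ?invr_ge0 ?mulr_ge0 ?exprn_ge0 ?normc_ge0//.
    apply: ler_pM; rewrite ?exprn_ge0 ?normc_ge0//; last exact: (hE _ (Dz k)).
    by rewrite lerXn2r ?nnegrE ?normc_ge0// (le_trans (normc_ge0 _) (xz k)).
  by rewrite lef_pV2 ?posrE// (lt_le_trans c0 ck).
have r_1 : r <= 1 by rewrite -(mul1r r).
have r2 : r ^+ 2 <= r by rewrite expr2 ler_piMr// ltW.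
have r20 : 0 <= r ^+ 2 by exact: sqr_ge0.
have r30 : 0 <= r ^+ 3 by rewrite exprn_ge0// ltW.
have r32 : r ^+ 3 <= r ^+ 2 by rewrite exprSr ler_piMr.
have alw k : normc (al * w k) <= M2 * r.
  by rewrite normcM nw ler_wpM2r// ltW.
have bew k : normc (be * w k ^+ 2 + er k) <= (M3 + C1) * r ^+ 2.
  apply: le_trans (normcD _ _) _; rewrite normcM normcXn nw mulrDl lerD//.
    by rewrite ler_wpM2r.
  by apply: le_trans (er_le k) _; rewrite ler_wpM2l.
pose E := M2 * (M3 + C1) * r ^+ 3.
(* [normc_1D_ge]; the cross term of the squared imaginary part goes into [E] *)
have term k : 1 + complex.Re (al * w k) + complex.Re (be * w k ^+ 2) - C1 * r ^+ 3
    + (complex.Im (al * w k) ^+ 2 - 2 * E) / 4 <= u * (normc P^`().[x k])^-1.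
  have -> : u * (normc P^`().[x k])^-1 = normc (1 + X k).
    by rewrite /X addrC subrK normcM normcV.
  have XE : X k = al * w k + (be * w k ^+ 2 + er k) by rewrite /er; ring.
  have X2 : normc (X k) <= 1 / 2.
    rewrite XE; apply: le_trans (normcD _ _) _; apply: le_trans rd.
    apply: le_trans (lerD (alw k) (bew k)) _.
    have : (M3 + C1) * r ^+ 2 <= (M3 + C1) * r by rewrite ler_wpM2l//; lra.
    lra.
  apply: le_trans (normc_1D_ge X2).
  have hRe : complex.Re (X k) = complex.Re (al * w k) + complex.Re (be * w k ^+ 2)
      + complex.Re (er k) by rewrite XE !raddfD addrA.
  have hIm : complex.Im (X k) = complex.Im (al * w k)
      + complex.Im (be * w k ^+ 2 + er k) by rewrite XE raddfD.
  have e1 : - (C1 * r ^+ 3) <= complex.Re (er k).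
    by have := le_trans (ler_Re_normc _) (er_le k); rewrite ler_norml => /andP[].
  have i1 := le_trans (ler_Im_normc _) (alw k).
  have i2 := le_trans (ler_Im_normc _) (bew k).
  have i3 : `|complex.Im (al * w k) * complex.Im (be * w k ^+ 2 + er k)| <= E.
    rewrite normrM; apply: le_trans (ler_pM _ _ i1 i2) _ => //.
    by rewrite /E le_eqVlt; apply/orP; left; apply/eqP; ring.
  rewrite hRe hIm; move: i3; rewrite ler_norml => /andP[i3 _].
  move: (complex.Im (al * w k)) (complex.Im (be * w k ^+ 2 + er k)) i3 => y d i3.
  have d0 := sqr_ge0 d.
  have -> : (y + d) ^+ 2 = y ^+ 2 + 2 * (y * d) + d ^+ 2 by ring.
  lra.
have sumT : 4 + r ^+ 2 * normc al ^+ 2 / 2 - C2 * r ^+ 3 <=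
    u * \sum_k (normc P^`().[x k])^-1.
  rewrite mulr_sumr; apply: le_trans (ler_sum _ (fun k _ => term k)).
  rewrite !(big_split, sumrB)/= -mulr_suml !(big_split, sumrB)/=.
  rewrite compass_sum compass_sum_sqr compass_sum_Im !sumr_const !card_ord.
  by rewrite le_eqVlt; apply/orP; left; apply/eqP; rewrite /C2 /E; field.
move: sumT; set S := \sum_k _ => sumT.
have al2 : normc al ^+ 2 = 4 * normc (nderiv2 P z) ^+ 2 / u ^+ 4.
  rewrite /al /recip_coef1 normcM normc_opp normcM normcV normcXn -/p1 -/u.
  have -> : normc (2 : R[i]) = 2 by rewrite -[2](rmorph_nat (real_complex R)) normc_real.
  by field; rewrite lt0r_neq0.
have : (4 + r ^+ 2 * normc al ^+ 2 / 2 - C2 * r ^+ 3) / u <= S.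
  by rewrite ler_pdivrMr// [leRHS]mulrC.
apply: le_trans; rewrite al2 -/p1 -/u.
set A := normc (nderiv2 P z) ^+ 2.
have A0 : 0 <= r ^+ 2 * A by rewrite mulr_ge0// sqr_ge0.
have -> : (4 + r ^+ 2 * (4 * A / u ^+ 4) / 2 - C2 * r ^+ 3) / u =
    4 * u^-1 + 2 / u ^+ 5 * (r ^+ 2 * A) - C2 * r ^+ 3 / u.
  by field; rewrite lt0r_neq0.
apply: lerB.
  rewrite lerD2l -mulrA ler_wpM2r// ler_pM2l// lef_pV2 ?posrE ?exprn_gt0//.
  by rewrite lerXn2r ?nnegrE// ltW.
have C2r : 0 <= C2 * r ^+ 3 by apply: mulr_ge0 => //; exact: ltW.
by rewrite [leRHS]mulrAC ler_wpM2l// lef_pV2 ?posrE.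
Qed.

End WithData.
End InverseExpansion.

(** * The length increases on average under translations *)

Section Submean.
Context {R : realType}.
Variables (n : nat) (P : {poly R[i]}) (B c eta rho L : R).
Hypothesis dP : regular_data n P B c eta rho L.
Hypothesis n_gt1 : (1 < n)%N.

Let n_gt0 : (0 < n)%N := ltnW n_gt1.
Let c0 : 0 < c := rd_c dP.
Let eta0 : 0 < eta.
Proof. by have /andP[] := rd_eta dP. Qed.
Let rho0 : 0 < rho.
Proof. by have /andP[] := rd_rho dP. Qed.
Let L0 : 0 <= L := rd_L dP.

Lemma regular_shift (w : R[i]) : normc w <= eta -> regular (P - w%:P).
Proof.
move=> weta z; rewrite hornerD hornerN hornerC derivB derivC subr0 => Pz.
rewrite -normc_gt0; apply: lt_le_trans c0 _; apply: (rd_deriv dP).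
rewrite -Pz; apply: le_trans (ler_dist_normc _ _) _.
by rewrite opprB addrCA subrr addr0.
Qed.

Lemma fiber_shift (w zeta : R[i]) : fiber (P - w%:P) zeta = fiber P (zeta + w).
Proof. by rewrite /fiber polyCD opprD addrA addrAC. Qed.

(** The roots of [P = zeta] move injectively to roots of [P = zeta + w], and a
    count shows that they reach all of them. *)
Lemma fiber_transport (zeta w : R[i]) : normc zeta = 1 -> normc w <= eta ->
  normc w < rho ^+ n -> 4 / c * normc w <= rho ->
  exists T : R[i] -> R[i],
    (forall z, z \in fiber P zeta ->
      P.[T z] = zeta + w /\ normc (T z - z) <= 2 / c * normc w) /\
    perm_eq [seq T z | z <- fiber P zeta] (fiber P (zeta + w)).
Proof.
move=> z1 weta wrho wc.
have lev z : z \in fiber P zeta -> `|normc P.[z] - 1| <= eta.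
  by rewrite (mem_fiber dP n_gt0) => /eqP->; rewrite z1 subrr normr0 ltW.
have /choice[T hT] : forall z, exists x, z \in fiber P zeta ->
    P.[x] = zeta + w /\ normc (x - z) <= 2 / c * normc w.
  move=> z; have [zf|_] := boolP (z \in fiber P zeta); last by exists 0.
  have Pz : P.[z] = zeta by apply/eqP; rewrite -(mem_fiber dP n_gt0).
  have [||x [_ Px _ xz]] := local_inverse dP n_gt0 (z := z) (zeta := zeta + w).
  - exact: lev.
  - by rewrite Pz opprD addrA subrr add0r normc_opp.
  - exists x => _; split=> //; apply: le_trans xz _.
    by rewrite Pz addrAC subrr add0r.
exists T; split=> //.
have T_inj : {in fiber P zeta &, injective T}.
  move=> x y xf yf Txy; have [_ hx] := hT _ xf; have [_ hy] := hT _ yf.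
  have xy : normc (y - x) <= rho.
    apply: le_trans (normc_triangle (T x) _ _) _.
    rewrite normcB {1}Txy; apply: le_trans (lerD hy hx) _.
    apply: le_trans wc; rewrite le_eqVlt; apply/orP; left; apply/eqP; ring.
  apply: (local_injective dP (lev _ xf)) => //.
    by rewrite subrr normc0 ltW.
  by apply/eqP; move: xf yf; rewrite !(mem_fiber dP n_gt0) => /eqP-> /eqP->.
have uT : uniq [seq T z | z <- fiber P zeta].
  by rewrite map_inj_in_uniq// (uniq_fiber dP n_gt0)// z1 subrr normr0 ltW.
have zw : `|normc (zeta + w) - 1| <= eta.
  rewrite -z1; apply: le_trans (ler_dist_normc _ _) _.
  by rewrite addrAC subrr add0r.
have sub : {subset [seq T z | z <- fiber P zeta] <= fiber P (zeta + w)}.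
  by move=> _ /mapP[z zf ->]; rewrite (mem_fiber dP n_gt0); have [-> _] := hT _ zf.
apply: uniq_perm => //; first exact: (uniq_fiber dP n_gt0).
have [] := uniq_min_size uT sub => //.
by rewrite size_map !(size_fiber dP n_gt0).
Qed.

(** The lemniscate is infinite while the second derivative, which is not zero in
    degree at least 2, has finitely many roots. *)
Lemma exists_quad_neq0 : exists t z, P.[z] = expi t /\ nderiv2 P z != 0.
Proof.
pose q := P^`N(2).
have q0 : q != 0.
  apply/eqP => q0; have : q`_(n - 2) = 0 by rewrite q0 coef0.
  rewrite coef_nderivn subnKC//; have := monicP (rd_monic dP).
  rewrite /lead_coef (rd_size dP)/= => -> /eqP.
  by rewrite pnatr_eq0; apply/negP; rewrite -lt0n bin_gt0.
pose m := size q.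
have m0 : (0 < m)%N by rewrite lt0n size_poly_eq0.
pose t (k : nat) : R := pi * k%:R / m%:R.
have /choice[z hz] : forall k, exists z, P.[z] = expi (t k).
  move=> k; have : (0 < size (fiber P (expi (t k))))%N by rewrite (size_fiber dP n_gt0).
  move=> /(mem_nth 0); rewrite (mem_fiber dP n_gt0) => /eqP h; by exists (fiber P (expi (t k)))`_0.
have [//|noz] := pselect (exists t z, P.[z] = expi t /\ nderiv2 P z != 0).
have aq : all (root q) [seq z k | k <- iota 0 m].
  apply/allP => _ /mapP[k _ ->]; apply/negPn/negP => qk.
  by apply: noz; exists (t k), (z k).
suff uq : uniq [seq z k | k <- iota 0 m].
  by have := max_poly_roots q0 aq uq; rewrite size_map size_iota ltnn.
have pi0 := pi_gt0 R.
rewrite map_inj_in_uniq ?iota_uniq// => k l; rewrite !mem_iota !add0n => /= km lm zkl.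
have tin (j : nat) : (j < m)%N -> t j \in `[0, pi].
  move=> jm; rewrite in_itv/= /t; apply/andP; split.
    by apply: divr_ge0 => //; apply: mulr_ge0 => //; exact: ltW.
  by rewrite ler_pdivrMr ?ltr0n// ler_pM2l// ler_nat ltnW.
have : cos (t k) = cos (t l).
  have : expi (t k) = expi (t l) by rewrite -hz -hz zkl.
  by case.
move=> /(cos_inj (tin _ km) (tin _ lm)) /eqP.
rewrite /t (inj_eq (mulIf _)) ?invr_eq0 ?pnatr_eq0 -?lt0n//.
by rewrite (inj_eq (mulfI _)) ?lt0r_neq0// eqr_nat => /eqP.
Qed.

(** Sum of [pointwise_submean] over the nodes and their preimages. The gain is
    nonnegative everywhere and bounded below at the first [M] of the [K * M]
    nodes, which are so close to [t0] that the second derivative does not vanish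
    at one of the preimages. It has order [r ^+ 2], so that it dominates the
    error of order [r ^+ 3] once [r] is small; both are independent of [M]. *)
Lemma riemann_submean : exists (r t0 : R) (K : nat) (gain : R),
  [/\ 0 <= r <= eta, (0 < K)%N, 0 < gain &
  forall M, (0 < M)%N ->
    4 * riemann_length (K * M) t0 P + gain <=
    \sum_k riemann_length (K * M) t0 (P - (compass r k)%:P)].
Proof.
have [t0 [zs [Pzs qzs]]] := exists_quad_neq0.
have [kappa [C [r1 [kappa0 C0 r10 submean]]]] := pointwise_submean dP.
pose q0 := normc (nderiv2 P zs).
have q00 : 0 < q0 by rewrite normc_gt0.
have [La La1 hLa] := poly_lipschitz P^`N(2) (B + 1).
have zsB : normc zs <= B := near_level_bounded dP (expi_level dP Pzs).
(* at every node within [tau] of [t0], [nderiv2] is at least [q0 / 2] at some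
   preimage *)
have [|tau tau0 htau] := @small_enough R
    [:: (2, rho ^+ n); (2 / c, 1); (La * (2 / c), q0 / 2)].
  have c2 : 0 <= 2 / c by apply: divr_ge0 => //; exact: ltW.
  have Lc : 0 <= La * (2 / c) by apply: mulr_ge0 => //; lra.
  by rewrite /= ltr01 ler0n c2 Lc exprn_gt0// divr_gt0.
have [K K0 hK] := mesh_small tau0.
have K0' : 0 < K%:R :> R by rewrite ltr0n.
pose g := q0 ^+ 2 / 4.
have g0 : 0 < g by rewrite divr_gt0 ?exprn_gt0.
have near_zs t : 0 <= t <= tau -> exists2 z, z \in fiber P (expi (t0 + t)) &
    g <= normc (nderiv2 P z) ^+ 2.
  move=> /andP[t_0 ttau]; have := htau tau; rewrite lexx (ltW tau0) => /(_ isT)/=.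
  rewrite andbT => /and3P[h1 h2 h3].
  have lev := expi_level dP Pzs.
  have dt : normc (expi (t0 + t) - expi t0) <= tau.
    apply: le_trans (normc_expiB_le _ _) _.
    by rewrite addrAC subrr add0r ger0_norm.
  have [||z [zf Pz _ zz]] := local_inverse dP n_gt0 (z := zs) (zeta := expi (t0 + t)).
  - exact: lev.
  - by rewrite Pzs normcB; apply: le_lt_trans dt _; lra.
  exists z => //; rewrite Pzs in zz.
  have zz2 : normc (z - zs) <= 2 / c * tau.
    apply: le_trans zz _; rewrite ler_wpM2l//.
    by apply: divr_ge0 => //; exact: ltW.
  have zB : normc z <= B + 1 by have := ler_normcB z zs; lra.
  have zsB1 : normc zs <= B + 1 by lra.
  have : normc (nderiv2 P z - nderiv2 P zs) <= q0 / 2.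
    apply: le_trans (hLa _ _ zB zsB1) _.
    by apply: le_trans h3; rewrite -mulrA ler_wpM2l//; lra.
  have := ler_normcB (nderiv2 P zs) (nderiv2 P z); rewrite normcB -/q0 => h4 h5.
  have h6 : q0 / 2 <= normc (nderiv2 P z) by lra.
  have -> : g = (q0 / 2) ^+ 2 by rewrite /g; field.
  by rewrite lerXn2r ?nnegrE ?normc_ge0// ltW// divr_gt0.
have [|r r0 hr] := @small_enough R [:: (1, r1); (1, eta); (2, rho ^+ n);
    (4 / c, rho); (n%:R * C, kappa * g / (2 * K%:R))].
  have c4 : 0 <= 4 / c by apply: divr_ge0 => //; exact: ltW.
  have nC : 0 <= n%:R * C by apply: mulr_ge0 => //; exact: ltW.
  have kg : 0 < kappa * g / (2 * K%:R) by rewrite divr_gt0// mulr_gt0.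
  by rewrite /= ler01 r10 eta0 rho0 ler0n c4 nC kg exprn_gt0.
have := hr r; rewrite lexx (ltW r0) => /(_ isT)/=.
rewrite andbT !mul1r => /and5P[rr1 reta rrho rc rgain].
have nw k : normc (compass r k) = r by rewrite normc_compass// ltW.
pose gain := pi *+ 2 * (kappa * r ^+ 2 * g / (2 * K%:R)).
have p2 : 0 < pi *+ 2 :> R by have := pi_gt0 R; rewrite mulr2n; lra.
exists r, t0, K, gain; split=> //.
- by rewrite (ltW r0).
- by rewrite /gain !mulr_gt0 ?exprn_gt0// invr_gt0 mulr_gt0.
move=> M M0; set N := (K * M)%N.
have N0 : (0 < N)%N by rewrite muln_gt0 K0.
pose zeta j := expi (node N t0 j).
pose quads j := \sum_(z <- fiber P (zeta j)) normc (nderiv2 P z) ^+ 2.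
have quads0 j : 0 <= quads j by apply: sumr_ge0 => z _; exact: sqr_ge0.
(* [pointwise_submean] summed over the roots above one node *)
have at_node j : 4 * speed_sum P (zeta j) + kappa * r ^+ 2 * quads j - n%:R * C * r ^+ 3
    <= \sum_k speed_sum (P - (compass r k)%:P) (zeta j).
  have /choice[T hT] : forall k, exists T : R[i] -> R[i],
      (forall z, z \in fiber P (zeta j) ->
        P.[T z] = zeta j + compass r k /\ normc (T z - z) <= 2 / c * r) /\
      perm_eq [seq T z | z <- fiber P (zeta j)] (fiber P (zeta j + compass r k)).
    move=> k; have := @fiber_transport (zeta j) (compass r k); rewrite nw; apply=> //.
      exact: normc_expi.
    by apply: lt_le_trans rrho; lra.
  have -> : \sum_k speed_sum (P - (compass r k)%:P) (zeta j) =
      \sum_(z <- fiber P (zeta j)) \sum_k (normc P^`().[T k z])^-1.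
    rewrite exchange_big/=; apply: eq_bigr => k _.
    rewrite /speed_sum fiber_shift derivB derivC subr0.
    by have [_ /(perm_big _) <-] := hT k; rewrite big_map.
  have -> : 4 * speed_sum P (zeta j) + kappa * r ^+ 2 * quads j - n%:R * C * r ^+ 3
    = \sum_(z <- fiber P (zeta j)) (4 * (normc P^`().[z])^-1
        + kappa * r ^+ 2 * normc (nderiv2 P z) ^+ 2 - C * r ^+ 3).
    rewrite sumrB big_split/= -!mulr_sumr; congr (_ - _).
    rewrite big_const_seq count_predT (size_fiber dP n_gt0) iter_addr addr0.
    by rewrite -[r *+ n]mulr_natl; ring.
  rewrite [leLHS]big_seq [leRHS]big_seq; apply: ler_sum => z zf.
  apply: submean; rewrite ?r0//.
  - by move: zf; rewrite (mem_fiber dP n_gt0) => /eqP->; rewrite normc_expi.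
  - move=> k; have [/(_ _ zf)[-> _] _] := hT k.
    by move: zf; rewrite (mem_fiber dP n_gt0) => /eqP->.
  - by move=> k; have [/(_ _ zf)[_ h] _] := hT k.
have quads_ge : g * M%:R <= \sum_(j < N) quads j.
  have MN : (M <= N)%N by rewrite /N leq_pmull.
  rewrite -(big_mkord predT quads) (big_cat_nat (leq0n M) MN)/= big_mkord.
  rewrite -[leLHS]addr0 lerD ?sumr_ge0//.
  have -> : g * M%:R = \sum_(j < M) g by rewrite sumr_const card_ord mulr_natr.
  apply: ler_sum => j _.
  have [|z zf hz] := near_zs (mesh N * j%:R).
    rewrite mulr_ge0 ?mesh_ge0//=; apply: le_trans (hK K (leqnn _)).
    have -> : mesh K = mesh N * M%:R :> R.
      by rewrite /mesh /N natrM; field; rewrite !pnatr_eq0 -!lt0n M0 K0.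
    by rewrite ler_pM2l ?mesh_gt0// ler_nat ltnW.
  apply: le_trans hz _; rewrite /quads (big_rem z)//= lerDl.
  by apply: sumr_ge0 => y _; exact: sqr_ge0.
rewrite /riemann_length -mulr_sumr exchange_big/=.
apply: (@le_trans _ _ (mesh N * \sum_(j < N) (4 * speed_sum P (zeta j)
    + kappa * r ^+ 2 * quads j - n%:R * C * r ^+ 3))); last first.
  by rewrite ler_pM2l ?mesh_gt0//; apply: ler_sum => j _; exact: at_node.
rewrite sumrB big_split/= -!mulr_sumr sumr_const card_ord.
have m0 := mesh_gt0 (R := R) N0.
have E1 : mesh N * M%:R = pi *+ 2 / K%:R :> R.
  by rewrite /mesh /N natrM; field; rewrite !pnatr_eq0 -!lt0n M0 K0.
have E2 := meshM (R := R) N0.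
set S := \sum_(j < N) speed_sum P _; set Q := \sum_(j < N) quads _.
have h1 : mesh N * (kappa * r ^+ 2 * (g * M%:R)) <= mesh N * (kappa * r ^+ 2 * Q).
  by rewrite !ler_pM2l// ?mulr_gt0 ?exprn_gt0.
have h2 : mesh N * (kappa * r ^+ 2 * (g * M%:R)) = 2 * gain.
  rewrite /gain; transitivity (mesh N * M%:R * (kappa * r ^+ 2 * g)); first by ring.
  by rewrite E1; field; rewrite lt0r_neq0.
have h3 : mesh N * ((n%:R * C * r ^+ 3) *+ N) <= gain.
  have -> : mesh N * ((n%:R * C * r ^+ 3) *+ N) = pi *+ 2 * (r ^+ 2 * (n%:R * C * r)).
    by rewrite -E2 -mulr_natr; ring.
  have -> : gain = pi *+ 2 * (r ^+ 2 * (kappa * g / (2 * K%:R))).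
    by rewrite /gain; ring.
  by rewrite ler_pM2l// ler_pM2l// exprn_gt0.
by rewrite mulrBr mulrDr; lra.
Qed.

End Submean.

(** * Conclusion *)

Theorem corollary5 (R : realType) (n : nat) (P : {poly R[i]})
    (n_ge2 : (2 <= n)%N) (extP : extremal n P) :
  [set z : R[i] | P^`().[z] = 0] `&` lemniscate P !=set0.
Proof.
have [Pm Ps Pmax] := extP.
have n_gt0 : (0 < n)%N by apply: ltnW.
have [//|nosing] := pselect ([set z : R[i] | P^`().[z] = 0] `&` lemniscate P !=set0).
have Preg : regular P.
  move=> z Pz; apply/eqP => dPz; apply: nosing; exists z; split=> //=.
  by apply/eqP; rewrite norm_eq1 Pz.
have [B [c [eta [rho [L dP]]]]] := regular_dataP n_gt0 Pm Ps Preg.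
have [r [t0 [K [gain [/andP[r0 reta] K0 gain0 submean]]]]] := riemann_submean dP n_ge2.
pose Q k := P - (compass r k)%:P.
have Qm k : Q k \is monic.
  rewrite monicE lead_coefDl ?(monicP Pm)// size_polyN Ps.
  by rewrite (leq_ltn_trans (size_polyC_leq1 _)).
have Qs k : size (Q k) = n.+1.
  by rewrite size_polyDl Ps// size_polyN (leq_ltn_trans (size_polyC_leq1 _)).
have Qreg k : regular (Q k).
  by apply: (regular_shift dP); rewrite normc_compass.
(* 16 = 4 + 4 * (1 + 2): one [e] for approximating each of the four lengths,
   one for the length of [P], and two for the margin in [content_le] *)
pose e := gain / 16.
have e0 : 0 < e by rewrite divr_gt0.
have /choice[NQ hNQ] : forall k, exists N0, forall N, (N0 <= N)%N ->
    ((riemann_length N t0 (Q k) - e)%:E <= hausdorff_length (lemniscate P))%E.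
  move=> k; have [Bk [ck [ek [rk [Lk dQ]]]]] := regular_dataP n_gt0 (Qm k) (Qs k) (Qreg k).
  have [N0 _ hN0] := riemann_lower dQ n_gt0 t0 e0.
  exists N0 => N /hN0/le_trans; apply; exact: Pmax.
(* comparing Riemann sums with a common mesh *)
have content_le delta : 0 < delta ->
    (hausdorff_content delta (lemniscate P) + (2 * e)%:E
      <= hausdorff_length (lemniscate P))%E.
  move=> delta0.
  have [N0 _ hN0] := riemann_upper dP n_gt0 t0 e0 delta0.
  pose M := (N0 + \sum_k NQ k).+1.
  have KM m : (m < M)%N -> (m <= K * M)%N.
    by move=> mM; rewrite (leq_trans (ltnW mM))// leq_pmull.
  have hP := hN0 (K * M)%N (KM _ (leq_addr _ _ : (N0 < M)%N)).
  have hQ k : ((riemann_length (K * M) t0 (Q k) - e)%:E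
      <= hausdorff_length (lemniscate P))%E.
    apply: hNQ; apply: KM; rewrite ltnS /=.
    by rewrite (bigD1 k)//= addnCA leq_addr.
  have hM := submean M isT.
  move: hQ; case: hausdorff_length => [l| |] hQ.
  - apply: le_trans (leeD2r _ hP) _; rewrite -EFinD lee_fin.
    have : \sum_k (riemann_length (K * M) t0 (Q k) - e) <= \sum_(k < 4) l.
      by apply: ler_sum => k _; have := hQ k; rewrite lee_fin.
    rewrite sumrB !sumr_const !card_ord; rewrite -/Q in hM; rewrite /e; lra.
  - exact: leey.
  - by have := hQ ord0; rewrite leeNy_eq.
have length_fin : (hausdorff_length (lemniscate P) <= (pi *+ 2 * n%:R / c + 1)%:E)%E.
  apply: ge_ereal_sup => _ [delta /= delta0 <-].
  have [N0 N00 hN0] := riemann_upper dP n_gt0 t0 ltr01 delta0.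
  apply: le_trans (hN0 N0 (leqnn _)) _; rewrite lee_fin lerD2r.
  exact: (riemann_length_le dP n_gt0 t0 N00).
have length_le : (hausdorff_length (lemniscate P) + (2 * e)%:E
    <= hausdorff_length (lemniscate P))%E.
  rewrite -leeBrDr//; apply: ge_ereal_sup => _ [delta delta0 <-].
  by rewrite leeBrDr//; exact: content_le.
have := hNQ ord0 _ (leqnn _); move: length_fin length_le.
case: hausdorff_length => [l _|//|_ _]; last by rewrite leeNy_eq.
by rewrite -EFinD lee_fin gerDl leNgt mulr_gt0.
Qed.
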